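(* Let $X$ be a finite mc-biquandle. For an oriented (classical or virtual) link $L$, let $\Phi^{\mathbb{Z}}_X(L)=|\mathrm{Hom}(\mathcal{MCB}(L),X)|$, which is the number of $X$-colorings of any diagram of $L$. Then $\Phi^{\mathbb{Z}}_X$ is an integer-valued invariant of oriented links. That is, for any diagram $D$ of $L$ the number of $X$-colorings of $D$ is equal to $\Phi^{\mathbb{Z}}_X(L)$, and any two diagrams of the same oriented link have the same number of $X$-colorings.
   Context: **mc-biquandles.** An mc-biquandle is a set $X$ with two pairs of binary operations $\underline{\triangleright}^s,\overline{\triangleright}^s$ and $\underline{\triangleright}^m,\overline{\triangleright}^m$ such that: (i) for all $x\in X$, $x\,\overline{\triangleright}^s x=x\,\underline{\triangleright}^s x$; (ii) for all $y\in X$ and $j\in\{s,m\}$, the maps $\alpha^j_y,\beta^j_y:X\to X$, $\alpha^j_y(x)=x\,\underline{\triangleright}^j y$, $\beta^j_y(x)=x\,\overline{\triangleright}^j y$, are invertible, and the map $S^j:X\times X\to X\times X$, $S^j(x,y)=(y\,\overline{\triangleright}^j x,\;x\,\underline{\triangleright}^j y)$, is invertible; (iii) for all $x,y,z\in X$ and all $(j,k,l)\in\{(s,s,s),(s,m,m),(m,s,m),(m,m,s),(m,m,m)\}$: $$(x\,\overline{\triangleright}^k y)\,\overline{\triangleright}^l (z\,\overline{\triangleright}^j y)=(x\,\overline{\triangleright}^l z)\,\overline{\triangleright}^k (y\,\underline{\triangleright}^j z),$$ $$(x\,\underline{\triangleright}^l y)\,\overline{\triangleright}^j (z\,\underline{\triangleright}^k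 y)=(x\,\overline{\triangleright}^j z)\,\underline{\triangleright}^l (y\,\overline{\triangleright}^k z),$$ $$(x\,\underline{\triangleright}^k y)\,\underline{\triangleright}^j (z\,\underline{\triangleright}^l y)=(x\,\underline{\triangleright}^j z)\,\underline{\triangleright}^k (y\,\overline{\triangleright}^l z).$$ A homomorphism of mc-biquandles is a map preserving all four operations; $\mathrm{Hom}(Y,X)$ is the set of homomorphisms $Y\to X$. **Diagrams.** Two diagrams of oriented classical links represent the same link iff they are related by planar isotopy and oriented Reidemeister moves I, II, III; for virtual link diagrams one also allows the virtual moves (detour moves). A classical (non-virtual) crossing is single-component (type $s$) if both its strands belong to the same component of the link, and multi-component (type $m$) if they belong to different components. Semiarcs are the pieces obtained by cutting the diagram at all classical crossing points, on both the over- and the understrand (virtual crossings do not cut; a component with no classical crossing contributes one semiarc). **Crossing relations and colorings.** At a classical crossing of type $l\in\{s,m\}$, let $x$ be the semiarc of the understrand lying to the right of the oriented overstrand, $y$ the semiarc of the overstrand lying to the right of the oriented understrand, $x'$ the other understrand semiarc and $y'$ the other overstrand semiarc. The crossing relations are $x'=x\,\underline{\triangleright}^l y$ and $y'=y\,\overline{\triangleright}^l x$. (For a positive crossing $x$ is the incoming under-semiarc and $y$ the outgoing over-semiarc; for a negative crossing $x$ is the outgoing under-semiarc and $y$ the incoming over-semiarc.) Nothing is imposed at virtual crossings. An $X$-coloring (mc-biquandle coloring) of a diagram $D$ is an assignment of elements of $X$ to the semiarcs of $D$ satisfying the crossing relations at every classical crossing. **Fundamental mc-biquandle.** For a diagram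 $D$, $\mathcal{MCB}(D)$ is defined as follows. Take one generator for each semiarc of $D$. An mc-biquandle word is a generator or an expression of one of the forms $w\,\underline{\triangleright}^l w'$, $w\,\overline{\triangleright}^l w'$, $(\alpha^l_{w})^{-1}(w')$, $(\beta^l_{w})^{-1}(w')$, $(S^l)^{-1}_i(w,w')$, where $l\in\{s,m\}$, $i\in\{1,2\}$, $w,w'$ are mc-biquandle words, and $(S^l)^{-1}_i$ denotes the $i$-th component of $(S^l)^{-1}$. The elements of $\mathcal{MCB}(D)$ are the equivalence classes of mc-biquandle words under the congruence generated by the mc-biquandle axioms and the crossing relations at all classical crossings of $D$. For a link $L$, $\mathcal{MCB}(L)$ denotes $\mathcal{MCB}(D)$ for a diagram $D$ of $L$ (independent of $D$ up to isomorphism). *)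

(* Defs.v *)
From HB Require Import structures.
From mathcomp Require Import all_boot finmap.
From mathcomp Require Import boolp classical_sets functions cardinality.
From Stdlib Require Import Relation_Operators.

Set Implicit Arguments.
Unset Strict Implicit.
Unset Printing Implicit Defensive.

(** * Mc-biquandles *)

(** Single-component (s) and multi-component (m) crossings. *)
Inductive ctype := Single | Multi.

Definition admissible (j k l : ctype) : bool :=
  match j, k, l with
  | Single, Single, Single | Single, Multi, Multi | Multi, Single, Multi
  | Multi, Multi, Single | Multi, Multi, Multi => true
  | _, _, _ => false
  end.

(** [under l x y] and [over l x y] are x triangle^l y with the triangle
    underlined, resp. overlined. *)
HB.mixin Record isMCBiquandle X := {
  under : ctype -> X -> X -> X;
  over : ctype -> X -> X -> X;
  mcb_diag : forall x, over Single x x = under Single x x;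
  mcb_under_bij : forall j y, bijective (fun x => under j x y);
  mcb_over_bij : forall j y, bijective (fun x => over j x y);
  mcb_S_bij : forall j,
    bijective (fun p : X * X => (over j p.2 p.1, under j p.1 p.2));
  mcb_exch_oo : forall j k l, admissible j k l -> forall x y z,
    over l (over k x y) (over j z y) = over k (over l x z) (under j y z);
  mcb_exch_uo : forall j k l, admissible j k l -> forall x y z,
    over j (under l x y) (under k z y) = under l (over j x z) (over k y z);
  mcb_exch_uu : forall j k l, admissible j k l -> forall x y z,
    under j (under k x y) (under l z y) = under k (under j x z) (over l y z)
}.

#[short(type="mcBiquandleType")]
HB.structure Definition MCBiquandle := {X of isMCBiquandle X}.

#[short(type="finMCBiquandleType")]
HB.structure Definition FinMCBiquandle := {X of Finite X & isMCBiquandle X}.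

Definition is_mc_hom (Y X : mcBiquandleType) (f : Y -> X) : Prop :=
  forall l, {morph f : x y / under l x y} /\ {morph f : x y / over l x y}.

Definition Hom (Y X : mcBiquandleType) : set (Y -> X) :=
  [set f | is_mc_hom f]%classic.
Arguments Hom : clear implicits.

(** * Oriented link diagrams

    A diagram is given by an oriented planar diagram code.  The curve is cut
    at its crossings, and possibly at finitely many further marked points,
    into oriented arcs labelled by natural numbers; the code lists the nodes
    at which the arcs are joined.

    - [Marker a b]: a marked point, where [a] ends and [b] starts;
      [Marker a a] is a circle without crossings.
    - [Crossing e a b c d]: a classical crossing with overstrand [a -> b] and
      understrand [c -> d], positive when [e] and negative otherwise.
    - [Virtual a b c d]: a virtual crossing of the strands [a -> b] and
      [c -> d], the second passing from the right to the left of the first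
      (each virtual crossing has a unique such presentation). *)
Inductive node :=
  | Marker of nat & nat
  | Crossing of bool & nat & nat & nat & nat
  | Virtual of nat & nat & nat & nat.

Definition node_encode (n : node) :=
  match n with
  | Marker a b => inl (a, b)
  | Crossing e a b c d => inr (Some e, (a, b, c, d))
  | Virtual a b c d => inr (None, (a, b, c, d))
  end.

Definition node_decode
    (x : (nat * nat) + (option bool * (nat * nat * nat * nat))) :=
  match x with
  | inl (a, b) => Marker a b
  | inr (Some e, (a, b, c, d)) => Crossing e a b c d
  | inr (None, (a, b, c, d)) => Virtual a b c d
  end.

Lemma node_encodeK : cancel node_encode node_decode.
Proof. by case. Qed.

HB.instance Definition _ := Countable.copy node (can_type node_encodeK).

Definition code := seq node.

Definition node_strands (n : node) : seq (nat * nat) :=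
  match n with
  | Marker a b => [:: (a, b)]
  | Crossing _ a b c d | Virtual a b c d => [:: (a, b); (c, d)]
  end.

(** The strands along which a node does not cut the curve. *)
Definition node_uncut (n : node) : seq (nat * nat) :=
  if n is Crossing _ _ _ _ _ then [::] else node_strands n.

Definition strands (D : code) := flatten [seq node_strands n | n <- D].

Definition labels (D : code) := unzip1 (strands D).

(** Every label ends at exactly one place and starts at exactly one place. *)
Definition well_formed (D : code) :=
  uniq (labels D) && perm_eq (labels D) (unzip2 (strands D)).

Definition lab (D : code) := seq_sub (labels D).

Definition relabel_node (f : nat -> nat) (n : node) : node :=
  match n with
  | Marker a b => Marker (f a) (f b)
  | Crossing e a b c d => Crossing e (f a) (f b) (f c) (f d)
  | Virtual a b c d => Virtual (f a) (f b) (f c) (f d)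
  end.

Definition relabel (f : nat -> nat) (D : code) : code :=
  map (relabel_node f) D.

(** ** Planarity

    The code determines a 4-valent graph (with some 2-valent vertices)
    embedded in a closed oriented surface.  A dart [(a, true)], resp.
    [(a, false)], is the arc [a] traversed along, resp. against, its
    orientation, with a face on its left; [node_turns] lists the pairs of
    darts following each other at a node along the boundary of that face.
    The surface is a disjoint union of spheres iff V - E + F = 2 C. *)
Definition dart := (nat * bool)%type.

Definition square_turns (a b c d : nat) : seq (dart * dart) :=
  [:: ((a, true), (d, true)); ((d, false), (b, true));
      ((b, false), (c, false)); ((c, true), (a, false))].

Definition node_turns (n : node) : seq (dart * dart) :=
  match n with
  | Marker a b => [:: ((a, true), (b, true)); ((b, false), (a, false))]
  | Crossing true a b c d | Virtual a b c d => square_turns a b c d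
  | Crossing false a b c d => square_turns c d a b
  end.

Definition turns (D : code) := flatten [seq node_turns n | n <- D].

Definition face_rel (D : code) : rel (lab D * bool) :=
  fun x y => let dx := (val x.1, x.2) in let dy := (val y.1, y.2) in
    ((dx, dy) \in turns D) || ((dy, dx) \in turns D).

Definition node_ends (n : node) : seq nat :=
  unzip1 (node_strands n) ++ unzip2 (node_strands n).

Definition adjacent_rel (D : code) : rel (lab D) :=
  fun x y => has (fun n => (val x \in node_ends n) && (val y \in node_ends n)) D.

Definition planar (D : code) : bool :=
  size D + n_comp (@face_rel D) predT
    == size (labels D) + 2 * n_comp (@adjacent_rel D) predT.

(** ** Diagrams *)

Inductive flavor := classical | virtual.

Definition is_virtual_crossing (n : node) : bool :=
  if n is Virtual _ _ _ _ then true else false.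

Definition is_diagram (t : flavor) (D : code) : bool :=
  [&& well_formed D, planar D &
      if t is classical then ~~ has is_virtual_crossing D else true].

Record diagram (t : flavor) := Diagram {
  diagram_code :> code;
  diagramP : is_diagram t diagram_code
}.

HB.instance Definition _ t := [isSub for @diagram_code t].
HB.instance Definition _ t := [Countable of diagram t by <:].

(** ** Semiarcs, components and crossing types *)

Definition sym_rel (T : Type) (e : rel T) : rel T := fun x y => e x y || e y x.

Lemma connect_sym_rel (T : finType) (e : rel T) : connect_sym (sym_rel e).
Proof.
apply: sym_connect_sym => x y; exact: orbC.
Qed.

Definition uncut_rel (D : code) : rel (lab D) :=
  sym_rel (fun a b => has (fun n => (val a, val b) \in node_uncut n) D).

Definition component_rel (D : code) : rel (lab D) :=
  sym_rel (fun a b => (val a, val b) \in strands D).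

(** A semiarc is a class of labels joined through markers and virtual
    crossings, represented by its canonical element. *)
Definition semiarc (D : code) := {a : lab D | a \in roots (@uncut_rel D)}.

Definition semiarc_of (D : code) (a : lab D) : semiarc D :=
  exist _ (root (@uncut_rel D) a) (roots_root (@connect_sym_rel _ _) a).

Definition crossing_type (D : code) (o u : lab D) : ctype :=
  if connect (@component_rel D) o u then Single else Multi.

(** [crossing_at l x y x' y']: the diagram has a classical crossing of type
    [l], where [x] is the understrand semiarc to the right of the overstrand,
    [y] is the overstrand semiarc to the right of the understrand, and [x'],
    [y'] are the other under- and overstrand semiarcs. *)
Definition crossing_at (D : code) (l : ctype) (x y x' y' : semiarc D) : Prop :=
  exists (e : bool) (o o' u u' : lab D),
    [/\ Crossing e (val o) (val o') (val u) (val u') \in D,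
        l = crossing_type o u &
        if e then [/\ x = semiarc_of u, y = semiarc_of o',
                      x' = semiarc_of u' & y' = semiarc_of o]
        else [/\ x = semiarc_of u', y = semiarc_of o,
                 x' = semiarc_of u & y' = semiarc_of o']].

(** * Colorings *)

Definition is_coloring (D : code) (X : mcBiquandleType) (f : semiarc D -> X) :
    Prop :=
  forall l x y x' y', crossing_at l x y x' y' ->
    f x' = under l (f x) (f y) /\ f y' = over l (f y) (f x).

Definition num_colorings (D : code) (X : finMCBiquandleType) : nat :=
  #|[pred f : {ffun semiarc D -> X} | `[< is_coloring f >]]|.

(** * Links *)

(** A crossing of the strands [p.1 -> p.2] and [q.1 -> q.2], classical with
    the first one over, or virtual.  With [e], the second strand passes from
    the right to the left of the first one; for a classical crossing this
    says that it is positive. *)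
Definition meet (k : flavor) (e : bool) (p q : nat * nat) : node :=
  match k with
  | classical => Crossing e p.1 p.2 q.1 q.2
  | virtual => if e then Virtual p.1 p.2 q.1 q.2 else Virtual q.1 q.2 p.1 p.2
  end.

Definition half (first : bool) (a m b : nat) : nat * nat :=
  if first then (a, m) else (m, b).

(** Three pairwise crossing strands [ai -> mi -> bi] bounding a triangle.  The
    booleans [eij] say, as in [meet], how strand [j] crosses strand [i].  On
    three oriented lines with these crossing signs, [tau] being the
    assertion that line 2 meets line 1 before line 3, line 1 meets line 2
    before line 3 iff the product of the signs [tau], [e13], [e23] is
    positive, and line 3 meets line 1 before line 2 iff the product of the
    signs [tau], [e12], [e13] is positive.  Moving one line across the
    intersection point of the two others reverses [tau]. *)
Definition triangle (k12 k13 k23 : flavor) (e12 e13 e23 tau : bool)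
    (a1 m1 b1 a2 m2 b2 a3 m3 b3 : nat) : code :=
  let f1 := tau == (e13 == e23) in
  let f3 := tau == (e12 == e13) in
  [:: meet k12 e12 (half f1 a1 m1 b1) (half tau a2 m2 b2);
      meet k13 e13 (half (~~ f1) a1 m1 b1) (half f3 a3 m3 b3);
      meet k23 e23 (half (~~ tau) a2 m2 b2) (half (~~ f3) a3 m3 b3)].

(** The kinds of crossings in a triangle move: all classical (with strand 1
    above strand 2 above strand 3), or an arc with only virtual crossings
    moving across a classical or virtual crossing.  Moving a strand over or
    under a virtual crossing is forbidden. *)
Definition triangle_kinds (k12 k13 k23 : flavor) : bool :=
  match k12, k13, k23 with
  | classical, classical, virtual | classical, virtual, classical
  | virtual, classical, classical => false
  | _, _, _ => true
  end.

(** Reidemeister moves I, II, III with all orientations and, for the flavor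
    [virtual] of the crossings, the virtual and mixed moves. *)
Inductive local_move : code -> code -> Prop :=
  | Move1 k e a c b (first : bool) :
      local_move [:: Marker a b]
        [:: if first then meet k e (a, c) (c, b) else meet k e (c, b) (a, c)]
  | Move2 k e a m b c n d (parallel : bool) :
      local_move [:: Marker a b; Marker c d]
        [:: meet k e (a, m) (half parallel c n d);
            meet k (~~ e) (m, b) (half (~~ parallel) c n d)]
  | Move3 k12 k13 k23 e12 e13 e23 a1 m1 b1 a2 m2 b2 a3 m3 b3 :
      triangle_kinds k12 k13 k23 ->
      local_move
        (triangle k12 k13 k23 e12 e13 e23 true a1 m1 b1 a2 m2 b2 a3 m3 b3)
        (triangle k12 k13 k23 e12 e13 e23 false a1 m1 b1 a2 m2 b2 a3 m3 b3).

(** [step_perm], [step_relabel] and [step_marker] only change the code of a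
    diagram.  In [step_local] the labels interior to the local picture are
    distinct from those of [K], since both codes are diagrams. *)
Inductive step (t : flavor) (D1 D2 : diagram t) : Prop :=
  | step_perm of perm_eq (D1 : code) (D2 : code)
  | step_relabel f of {in labels D1 &, injective f} &
      (D2 : code) = relabel f D1
  | step_marker a b K of a != b & (D1 : code) = Marker a b :: K &
      (D2 : code) = relabel (fun x => if x == b then a else x) K
  | step_local L R K of local_move L R & (D1 : code) = L ++ K &
      (D2 : code) = R ++ K.

Definition same_link (t : flavor) : rel (diagram t) :=
  fun D1 D2 => `[< clos_refl_sym_trans _ (@step t) D1 D2 >].

Lemma same_link_equiv (t : flavor) : equiv_class_of (@same_link t).
Proof.
split.
- move=> x; apply/asboolP; exact: rst_refl.
- by move=> x y; apply/asboolP/asboolP; exact: rst_sym.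
- by move=> y x z /asboolP xy /asboolP yz; apply/asboolP; exact: rst_trans yz.
Qed.

Canonical same_link_eqrel (t : flavor) :=
  EquivRelPack (same_link_equiv t).

Definition link (t : flavor) := {eq_quot (@same_link_eqrel t)}%qT.

Definition diagram_of (t : flavor) (L : link t) (D : diagram t) : Prop :=
  (\pi_({eq_quot (@same_link_eqrel t)}) D)%qT = L.

(** * The fundamental mc-biquandle *)

(** [UnderInv l y x] is (alpha^l_y)^{-1}(x), [OverInv l y x] is
    (beta^l_y)^{-1}(x), [SInv1 l x y] and [SInv2 l x y] are the components of
    (S^l)^{-1}(x, y). *)
Inductive word (D : code) : Type :=
  | Gen of semiarc D
  | Under of ctype & word D & word D
  | Over of ctype & word D & word D
  | UnderInv of ctype & word D & word D
  | OverInv of ctype & word D & word D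
  | SInv1 of ctype & word D & word D
  | SInv2 of ctype & word D & word D.

HB.instance Definition _ D := gen_eqMixin (word D).
HB.instance Definition _ D := gen_choiceMixin (word D).

Inductive cong (D : code) : word D -> word D -> Prop :=
  | cong_refl v : cong v v
  | cong_sym v w : cong v w -> cong w v
  | cong_trans u v w : cong u v -> cong v w -> cong u w
  | cong_Under l v v' w w' :
      cong v v' -> cong w w' -> cong (Under l v w) (Under l v' w')
  | cong_Over l v v' w w' :
      cong v v' -> cong w w' -> cong (Over l v w) (Over l v' w')
  | cong_UnderInv l v v' w w' :
      cong v v' -> cong w w' -> cong (UnderInv l v w) (UnderInv l v' w')
  | cong_OverInv l v v' w w' :
      cong v v' -> cong w w' -> cong (OverInv l v w) (OverInv l v' w')
  | cong_SInv1 l v v' w w' :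
      cong v v' -> cong w w' -> cong (SInv1 l v w) (SInv1 l v' w')
  | cong_SInv2 l v v' w w' :
      cong v v' -> cong w w' -> cong (SInv2 l v w) (SInv2 l v' w')
  | cong_diag x : cong (Over Single x x) (Under Single x x)
  | cong_UnderK l x y : cong (UnderInv l y (Under l x y)) x
  | cong_UnderVK l x y : cong (Under l (UnderInv l y x) y) x
  | cong_OverK l x y : cong (OverInv l y (Over l x y)) x
  | cong_OverVK l x y : cong (Over l (OverInv l y x) y) x
  | cong_SK1 l x y : cong (SInv1 l (Over l y x) (Under l x y)) x
  | cong_SK2 l x y : cong (SInv2 l (Over l y x) (Under l x y)) y
  | cong_SVK1 l x y : cong (Over l (SInv2 l x y) (SInv1 l x y)) x
  | cong_SVK2 l x y : cong (Under l (SInv1 l x y) (SInv2 l x y)) y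
  | cong_exch_oo j k l x y z : admissible j k l ->
      cong (Over l (Over k x y) (Over j z y))
           (Over k (Over l x z) (Under j y z))
  | cong_exch_uo j k l x y z : admissible j k l ->
      cong (Over j (Under l x y) (Under k z y))
           (Under l (Over j x z) (Over k y z))
  | cong_exch_uu j k l x y z : admissible j k l ->
      cong (Under j (Under k x y) (Under l z y))
           (Under k (Under j x z) (Over l y z))
  | cong_crossing_under l x y x' y' : crossing_at l x y x' y' ->
      cong (Gen x') (Under l (Gen x) (Gen y))
  | cong_crossing_over l x y x' y' : crossing_at l x y x' y' ->
      cong (Gen y') (Over l (Gen y) (Gen x)).

Definition congb (D : code) : rel (word D) := fun v w => `[< cong v w >].

Lemma congb_equiv (D : code) : equiv_class_of (@congb D).
Proof.
split.
- by move=> x; apply/asboolP; exact: cong_refl.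
- by move=> x y; apply/asboolP/asboolP; exact: cong_sym.
- by move=> y x z /asboolP xy /asboolP yz; apply/asboolP; exact: cong_trans yz.
Qed.

Canonical congb_eqrel (D : code) := EquivRelPack (congb_equiv D).

Definition MCB (D : code) := {eq_quot (@congb_eqrel D)}%qT.

Section MCBStructure.
Variable D : code.
Local Open Scope quotient_scope.

Definition mcb_class (w : word D) : MCB D := \pi_({eq_quot (@congb_eqrel D)}) w.

Definition mcb_repr (a : MCB D) : word D :=
  repr (a : {eq_quot (@congb_eqrel D)}).

Lemma mcb_reprK a : mcb_class (mcb_repr a) = a.
Proof. exact: reprK. Qed.

Lemma mcb_classP v w : mcb_class v = mcb_class w <-> cong v w.
Proof.
split=> [/eqmodP /asboolP //|vw].
by apply/eqmodP/asboolP.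
Qed.

Lemma cong_repr w : cong (mcb_repr (mcb_class w)) w.
Proof. by apply/mcb_classP; rewrite mcb_reprK. Qed.

Definition lift2 (op : word D -> word D -> word D) (a b : MCB D) : MCB D :=
  mcb_class (op (mcb_repr a) (mcb_repr b)).

Definition compatible (op : word D -> word D -> word D) :=
  forall v v' w w', cong v v' -> cong w w' -> cong (op v w) (op v' w').

Lemma lift2E op : compatible op -> forall v w,
  lift2 op (mcb_class v) (mcb_class w) = mcb_class (op v w).
Proof. by move=> opP v w; apply/mcb_classP/opP; exact: cong_repr. Qed.

Definition mcb_under l := lift2 (Under l).
Definition mcb_over l := lift2 (Over l).

Lemma mcb_underE l v w :
  mcb_under l (mcb_class v) (mcb_class w) = mcb_class (Under l v w).
Proof. by apply: lift2E => *; exact: cong_Under. Qed.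

Lemma mcb_overE l v w :
  mcb_over l (mcb_class v) (mcb_class w) = mcb_class (Over l v w).
Proof. by apply: lift2E => *; exact: cong_Over. Qed.

Lemma mcb_ind (P : MCB D -> Prop) :
  (forall w, P (mcb_class w)) -> forall a, P a.
Proof. by move=> Pw a; rewrite -(mcb_reprK a). Qed.

Fact mcb_diag_subproof x : mcb_over Single x x = mcb_under Single x x.
Proof.
elim/mcb_ind: x => x; rewrite mcb_overE mcb_underE.
by apply/mcb_classP; exact: cong_diag.
Qed.

Fact mcb_under_bij_subproof j y : bijective (fun x => mcb_under j x y).
Proof.
have VE v w : lift2 (UnderInv j) (mcb_class v) (mcb_class w)
    = mcb_class (UnderInv j v w).
  by apply: lift2E => *; exact: cong_UnderInv.
elim/mcb_ind: y => y.
exists (lift2 (UnderInv j) (mcb_class y)); elim/mcb_ind => x.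
- by rewrite mcb_underE VE; apply/mcb_classP; exact: cong_UnderK.
- by rewrite VE mcb_underE; apply/mcb_classP; exact: cong_UnderVK.
Qed.

Fact mcb_over_bij_subproof j y : bijective (fun x => mcb_over j x y).
Proof.
have VE v w : lift2 (OverInv j) (mcb_class v) (mcb_class w)
    = mcb_class (OverInv j v w).
  by apply: lift2E => *; exact: cong_OverInv.
elim/mcb_ind: y => y.
exists (lift2 (OverInv j) (mcb_class y)); elim/mcb_ind => x.
- by rewrite mcb_overE VE; apply/mcb_classP; exact: cong_OverK.
- by rewrite VE mcb_overE; apply/mcb_classP; exact: cong_OverVK.
Qed.

Fact mcb_S_bij_subproof j : bijective (fun p : MCB D * MCB D =>
  (mcb_over j p.2 p.1, mcb_under j p.1 p.2)).
Proof.
have E1 v w : lift2 (SInv1 j) (mcb_class v) (mcb_class w)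
    = mcb_class (SInv1 j v w).
  by apply: lift2E => *; exact: cong_SInv1.
have E2 v w : lift2 (SInv2 j) (mcb_class v) (mcb_class w)
    = mcb_class (SInv2 j v w).
  by apply: lift2E => *; exact: cong_SInv2.
exists (fun p => (lift2 (SInv1 j) p.1 p.2, lift2 (SInv2 j) p.1 p.2));
  case=> x y; elim/mcb_ind: x => x; elim/mcb_ind: y => y /=.
- rewrite mcb_overE mcb_underE E1 E2.
  by congr pair; apply/mcb_classP; [exact: cong_SK1 | exact: cong_SK2].
- rewrite E1 E2 mcb_overE mcb_underE.
  by congr pair; apply/mcb_classP; [exact: cong_SVK1 | exact: cong_SVK2].
Qed.

Fact mcb_exch_oo_subproof j k l : admissible j k l -> forall x y z,
  mcb_over l (mcb_over k x y) (mcb_over j z y)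
    = mcb_over k (mcb_over l x z) (mcb_under j y z).
Proof.
move=> jkl; elim/mcb_ind => x; elim/mcb_ind => y; elim/mcb_ind => z.
rewrite !(mcb_overE, mcb_underE); apply/mcb_classP; exact: cong_exch_oo.
Qed.

Fact mcb_exch_uo_subproof j k l : admissible j k l -> forall x y z,
  mcb_over j (mcb_under l x y) (mcb_under k z y)
    = mcb_under l (mcb_over j x z) (mcb_over k y z).
Proof.
move=> jkl; elim/mcb_ind => x; elim/mcb_ind => y; elim/mcb_ind => z.
rewrite !(mcb_overE, mcb_underE); apply/mcb_classP; exact: cong_exch_uo.
Qed.

Fact mcb_exch_uu_subproof j k l : admissible j k l -> forall x y z,
  mcb_under j (mcb_under k x y) (mcb_under l z y)
    = mcb_under k (mcb_under j x z) (mcb_over l y z).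
Proof.
move=> jkl; elim/mcb_ind => x; elim/mcb_ind => y; elim/mcb_ind => z.
rewrite !(mcb_overE, mcb_underE); apply/mcb_classP; exact: cong_exch_uu.
Qed.

HB.instance Definition _ := isMCBiquandle.Build (MCB D)
  mcb_diag_subproof mcb_under_bij_subproof mcb_over_bij_subproof
  mcb_S_bij_subproof mcb_exch_oo_subproof mcb_exch_uo_subproof
  mcb_exch_uu_subproof.

End MCBStructure.

(** * The counting invariant *)

Definition num_homs (Y : mcBiquandleType) (X : finMCBiquandleType) : nat :=
  #|` fset_set (Hom Y X : set (Y -> X))|%fset.

(** |Hom(MCB(L), X)|, with MCB(L) computed from a chosen diagram of [L]. *)
Definition Phi (X : finMCBiquandleType) (t : flavor) (L : link t) : nat :=
  num_homs (MCB (repr L)) X.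

(* Main.v *)
(** An assignment of colors to labels extends over each side of a Reidemeister
    move from the labels outside the move in exactly one way, or on neither
    side, so a move does not change the number of colorings.  A crossing is
    determined by the colors at any one of its corners, which settles move II;
    for move I, the first axiom and the invertibility of S make the map taking
    [c] to [under Single c c] injective, hence bijective as [X] is finite.  For
    move III the three exchange laws say that three colors [x], [y], [z], acting
    on each other at the crossings of the three strands, label the twelve edges
    of a cube consistently: the square faces are the crossings, the three faces
    around a corner form a triangle of crossings, and the triangle move passes
    from a corner to the opposite one.  A cube is determined by its edges at any
    one corner, so that, again by finiteness, every coloring of a triangle comes
    from a cube. *)

From mathcomp Require Import all_boot finmap zify.
From mathcomp Require Import boolp classical_sets functions cardinality.
From Stdlib Require Import Relation_Operators.
(* Last, because [under] is also a constant of ssreflect. *)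
Require Import Defs.

Set Implicit Arguments.
Unset Strict Implicit.
Unset Printing Implicit Defensive.

(** * Crossings, bigons and triangles in an mc-biquandle *)


Section Square.
Variable X : mcBiquandleType.
Implicit Types (l : ctype) (x y : X).

Lemma under_inj l y : injective (fun x : X => under l x y).
Proof. exact: bij_inj (mcb_under_bij l y). Qed.

Lemma over_inj l y : injective (fun x : X => over l x y).
Proof. exact: bij_inj (mcb_over_bij l y). Qed.

Lemma S_inj l x y x' y' :
  over l y x = over l y' x' -> under l x y = under l x' y' ->
  x = x' /\ y = y'.
Proof.
move=> eo eu.
by have [] := @bij_inj _ _ _ (mcb_S_bij l) (x, y) (x', y') (congr2 pair eo eu).
Qed.

(** Both [o] and [u] list the incoming color before the outgoing one. The sign of the crossing
    decides which of the two is the argument and which the result. *)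
Definition cross_rel l (e : bool) (o u : X * X) : Prop :=
  let: (x, y, x', y') :=
    if e then (u.1, o.2, u.2, o.1) else (u.2, o.1, u.1, o.2) in
  x' = under l x y /\ y' = over l y x.

(* A crossing seen from a corner between the over-semiarc [m] and the
   under-semiarc [n], with [o] and [v] the opposite semiarcs.  The bits [s]
   and [t] tell whether [m] and [n] are results of the operations. *)
Definition corner_rel l (s t : bool) (m o n v : X) : Prop :=
  let: (y, y') := if s then (o, m) else (m, o) in
  let: (x, x') := if t then (v, n) else (n, v) in
  x' = under l x y /\ y' = over l y x.

Definition halfv (first : bool) (a m b : X) := if first then (a, m) else (m, b).

(** The middle color of a strand leaves the crossing on the first half and enters it on the second,
    so a crossing of two halves is a corner at the two middle colors. *)
Lemma cross_relE l e f g a m b c n d :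
  cross_rel l e (halfv f a m b) (halfv g c n d) =
  corner_rel l (e != f) (e == g) m (if f then a else b) n (if g then c else d).
Proof. by case: e; case: f; case: g. Qed.

Lemma corner_rel_opp l s t m o n v :
  corner_rel l s t m o n v = corner_rel l (~~ s) (~~ t) o m v n.
Proof. by case: s; case: t. Qed.

(** If both given colors are results, invertibility of S^l determines the others; if just one is,
    invertibility of beta^l or alpha^l does; if none is, the operations compute them. *)
Lemma corner_rel_inj l s t m o n v o' v' :
  corner_rel l s t m o n v -> corner_rel l s t m o' n v' -> o = o' /\ v = v'.
Proof.
case: s; case: t => /= -[a b] -[a' b'].
- have eo := etrans (esym b) b'.
  by have [-> ->] := @S_inj l v o v' o' eo (etrans (esym a) a').
- have e : o = o' by apply: (@over_inj l n); rewrite -b -b'.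
  by rewrite a a' e.
- have e : v = v' by apply: (@under_inj l m); rewrite -a -a'.
  by rewrite b b' e.
- by rewrite a b a' b'.
Qed.

Lemma corner_rel_ex l s t m n : exists o v, corner_rel l s t m o n v.
Proof.
case: s; case: t => /=.
- have [g _ /(_ (m, n)) /= [gm gn]] := @mcb_S_bij X l.
  by exists (g (m, n)).2, (g (m, n)).1.
- have [g _ /(_ m) gm] := mcb_over_bij l n.
  by exists (g m), (under l n (g m)).
- have [g _ /(_ n) gn] := mcb_under_bij l m.
  by exists (over l m (g n)), (g n).
- by exists (over l m n), (under l n m).
Qed.

End Square.

(** * The cube spanned by three pairwise crossing strands *)

Section Cube.
Variables (X : finMCBiquandleType) (l12 l13 l23 : ctype).
Hypothesis adm : admissible l23 l13 l12.
Implicit Types (p : X * X * X) (s t : bool).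

(** The four parallel edges carry the colors of strand 1 before and after strands 2 and 3 act on it.
    When both have acted, one of two expressions is chosen; the exchange laws identify it with the
    other. [edge2] and [edge3] do the same for strands 2 and 3. *)
Definition edge1 p s2 s3 : X :=
  let: (x, y, z) := p in
  match s2, s3 with
  | false, false => x
  | true, false => over l12 x y
  | false, true => over l13 x z
  | true, true => over l12 (over l13 x z) (over l23 y z)
  end.

Definition edge2 p s1 s3 : X :=
  let: (x, y, z) := p in
  match s1, s3 with
  | false, false => y
  | true, false => under l12 y x
  | false, true => over l23 y z
  | true, true => over l23 (under l12 y x) (under l13 z x)
  end.

Definition edge3 p s1 s2 : X :=
  let: (x, y, z) := p in
  match s1, s2 with
  | false, false => z
  | true, false => under l13 z x
  | false, true => under l23 z y
  | true, true => under l23 (under l13 z x) (under l12 y x)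
  end.

(** The face away from the base corner is the mixed exchange law. In [face13] the corresponding face
    uses the other two laws, while both faces in [face23] hold by the choice of expressions. *)
Lemma face12 p s1 s2 s3 : corner_rel l12 s2 s1
  (edge1 p s2 s3) (edge1 p (~~ s2) s3) (edge2 p s1 s3) (edge2 p (~~ s1) s3).
Proof.
by case: p => [[x y] z]; case: s1; case: s2; case: s3;
  rewrite /= ?(mcb_exch_uo _ _ _ adm).
Qed.

Lemma face13 p s1 s2 s3 : corner_rel l13 s3 s1
  (edge1 p s2 s3) (edge1 p s2 (~~ s3)) (edge3 p s1 s2) (edge3 p (~~ s1) s2).
Proof.
by case: p => [[x y] z]; case: s1; case: s2; case: s3;
  rewrite /= ?(mcb_exch_oo _ _ _ adm) ?(mcb_exch_uu _ _ _ adm).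
Qed.

Lemma face23 p s1 s2 s3 : corner_rel l23 s3 s2
  (edge2 p s1 s3) (edge2 p s1 (~~ s3)) (edge3 p s1 s2) (edge3 p s1 (~~ s2)).
Proof.
by case: p => [[x y] z]; case: s1; case: s2; case: s3.
Qed.

(** Any two adjacent edges of a face determine the other two, so agreement spreads from one corner
    to all twelve edges, in particular to the base edges, which are [p] itself. *)
Lemma cube_corner_inj s1 s2 s3 :
  injective (fun p => (edge1 p s2 s3, edge2 p s1 s3, edge3 p s1 s2)).
Proof.
move=> p p' [e1 e2 e3].
have := face12 p' s1 s2 s3; rewrite -e1 -e2.
move=> /(corner_rel_inj (face12 p s1 s2 s3))[f1 f2].
have := face13 p' s1 s2 s3; rewrite -e1 -e3.
move=> /(corner_rel_inj (face13 p s1 s2 s3))[g1 g3].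
have := face23 p' s1 s2 s3; rewrite -e2 -e3.
move=> /(corner_rel_inj (face23 p s1 s2 s3))[h2 h3].
(* The three faces at the corner have settled nine edges; two further faces reach the remaining
   three. *)
have := face12 p' s1 s2 (~~ s3); rewrite -g1 -h2.
move=> /(corner_rel_inj (face12 p s1 s2 (~~ s3)))[i1 i2].
have := face13 p' s1 (~~ s2) s3; rewrite -f1 -h3.
move=> /(corner_rel_inj (face13 p s1 (~~ s2) s3))[_ i3].
have: edge1 p false false = edge1 p' false false.
  by case: s2 s3 e1 f1 g1 i1 {e2 e3 f2 g3 h2 h3 i2 i3} => -[].
have: edge2 p false false = edge2 p' false false.
  by case: s1 s3 e2 f2 h2 i2 {e1 e3 f1 g1 g3 h3 i1 i3} => -[].
have: edge3 p false false = edge3 p' false false.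
  by case: s1 s2 e3 g3 h3 i3 {e1 e2 f1 f2 g1 h2 i1 i2} => -[].
case: p p' {e1 e2 e3 f1 f2 g1 g3 h2 h3 i1 i2 i3} => -[x y] z [[x' y'] z'] /=.
by move=> -> -> ->.
Qed.

(** Finiteness of [X] enters here: an injective self-map of the set of triples is onto. *)
Lemma cube_corner s1 s2 s3 (m1 m2 m3 : X) :
  exists p, [/\ edge1 p s2 s3 = m1, edge2 p s1 s3 = m2 & edge3 p s1 s2 = m3].
Proof.
have [g _ /(_ (m1, m2, m3))[e1 e2 e3]] := injF_bij (@cube_corner_inj s1 s2 s3).
by exists (g (m1, m2, m3)).
Qed.

(* The eight orientation types of a triangle are the eight corners of the cube,
   and moving a strand across it exchanges opposite corners. *)
Definition triangle_rel (e12 e13 e23 tau : bool)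
    (a1 m1 b1 a2 m2 b2 a3 m3 b3 : X) : Prop :=
  let f1 := tau == (e13 == e23) in
  let f3 := tau == (e12 == e13) in
  [/\ cross_rel l12 e12 (halfv f1 a1 m1 b1) (halfv tau a2 m2 b2),
      cross_rel l13 e13 (halfv (~~ f1) a1 m1 b1) (halfv f3 a3 m3 b3) &
      cross_rel l23 e23 (halfv (~~ tau) a2 m2 b2) (halfv (~~ f3) a3 m3 b3)].

(** The three middle colors extend to a cube. Its faces at their corner force the outer colors to be
    edges of the cube, and the edges at the opposite corner, which have the same outer colors around
    them, are the new middle colors. *)
Lemma triangle_rel_opp e12 e13 e23 tau a1 m1 b1 a2 m2 b2 a3 m3 b3 :
  triangle_rel e12 e13 e23 tau a1 m1 b1 a2 m2 b2 a3 m3 b3 ->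
  exists m1 m2 m3,
    triangle_rel e12 e13 e23 (~~ tau) a1 m1 b1 a2 m2 b2 a3 m3 b3.
Proof.
rewrite /triangle_rel; cbv zeta; rewrite !cross_relE.
(* These bits name the corner formed by the middle colors. By the formulas for [f1] and [f3] the
   crossings agree on them, and reversing [tau] negates all three. *)
pose s1 := e12 == tau; pose s2 := e12 != (tau == (e13 == e23)).
pose s3 := e23 == tau.
have [p [<- <- <-]] := cube_corner s1 s2 s3 m1 m2 m3.
have E12 := face12 p s1 s2 s3; have F12 := face12 p (~~ s1) (~~ s2) (~~ s3).
have E13 := face13 p s1 s2 s3; have F13 := face13 p (~~ s1) (~~ s2) (~~ s3).
have E23 := face23 p s1 s2 s3; have F23 := face23 p (~~ s1) (~~ s2) (~~ s3).
move=> -[T12 T13 T23].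
exists (edge1 p (~~ s2) (~~ s3)), (edge2 p (~~ s1) (~~ s3)),
  (edge3 p (~~ s1) (~~ s2)).
rewrite !cross_relE.
move: @s1 @s2 @s3 E12 E13 E23 F12 F13 F23 T12 T13 T23.
case: tau e12 e13 e23 => -[] [] [] /= E12 E13 E23 F12 F13 F23.
all: move=> /(corner_rel_inj E12)[<- <-] /(corner_rel_inj E13)[<- <-].
all: by move=> /(corner_rel_inj E23)[<- <-].
Qed.

(** Seen from outside, the crossing of strands 1 and 2 determines [m1] and [m2], and that of strands
    2 and 3 then determines [m3]. *)
Lemma triangle_rel_inj e12 e13 e23 tau a1 m1 b1 a2 m2 b2 a3 m3 b3 m1' m2' m3' :
  triangle_rel e12 e13 e23 tau a1 m1 b1 a2 m2 b2 a3 m3 b3 ->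
  triangle_rel e12 e13 e23 tau a1 m1' b1 a2 m2' b2 a3 m3' b3 ->
  [/\ m1 = m1', m2 = m2' & m3 = m3'].
Proof.
rewrite /triangle_rel; cbv zeta; rewrite !cross_relE.
move=> -[T12 T13 T23] [T12' T13' T23']; move: T12 T12' T23 T23'.
rewrite !(corner_rel_opp _ _ _ m1) !(corner_rel_opp _ _ _ m1').
rewrite !(corner_rel_opp _ _ _ m2) !(corner_rel_opp _ _ _ m2').
by move=> T /(corner_rel_inj T)[-> ->] {}T /(corner_rel_inj T)[_ ->].
Qed.

Definition meet_rel (Y : mcBiquandleType) (k : flavor) l e (o u : Y * Y) : Prop :=
  if k is classical then cross_rel l e o u else o.1 = o.2 /\ u.1 = u.2.

Variables k12 k13 k23 : flavor.
Hypothesis kinds : triangle_kinds k12 k13 k23.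

Definition meet_triangle (e12 e13 e23 tau : bool)
    (a1 m1 b1 a2 m2 b2 a3 m3 b3 : X) : Prop :=
  let f1 := tau == (e13 == e23) in
  let f3 := tau == (e12 == e13) in
  [/\ meet_rel k12 l12 e12 (halfv f1 a1 m1 b1) (halfv tau a2 m2 b2),
      meet_rel k13 l13 e13 (halfv (~~ f1) a1 m1 b1) (halfv f3 a3 m3 b3) &
      meet_rel k23 l23 e23 (halfv (~~ tau) a2 m2 b2) (halfv (~~ f3) a3 m3 b3)].

(** Apart from the all-classical triangle, at least two crossings are virtual. Colors pass unchanged
    through these, so a remaining classical crossing meets the same colors on both sides of the
    move. *)
Lemma meet_triangle_opp e12 e13 e23 tau a1 m1 b1 a2 m2 b2 a3 m3 b3 :
  meet_triangle e12 e13 e23 tau a1 m1 b1 a2 m2 b2 a3 m3 b3 ->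
  exists m1 m2 m3,
    meet_triangle e12 e13 e23 (~~ tau) a1 m1 b1 a2 m2 b2 a3 m3 b3.
Proof.
rewrite /meet_triangle; case: k12 k13 k23 kinds => -[] [] //= _.
- exact: triangle_rel_opp.
(* The relation is only transported; generalizing it keeps simplification from unfolding it. *)
- move: (@cross_rel X l12) => R12.
  case: tau e12 e13 e23 => -[] [] [] /= -[T12 [? ?] [? ?]]; subst;
  by do 3 eexists; split; [exact: T12 | split; reflexivity..].
- move: (@cross_rel X l13) => R13.
  case: tau e12 e13 e23 => -[] [] [] /= -[[? ?] T13 [? ?]]; subst;
  by do 3 eexists; split;
    [split; reflexivity | exact: T13 | split; reflexivity].
- move: (@cross_rel X l23) => R23.
  case: tau e12 e13 e23 => -[] [] [] /= -[[? ?] [? ?] T23]; subst;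
  by do 3 eexists; split; [split; reflexivity.. | exact: T23].
- case: tau e12 e13 e23 => -[] [] [] /= -[[? ?] [? ?] [? ?]]; subst;
  by do 3 eexists; split; split; reflexivity.
Qed.

Lemma meet_triangle_inj e12 e13 e23 tau a1 m1 b1 a2 m2 b2 a3 m3 b3 m1' m2' m3' :
  meet_triangle e12 e13 e23 tau a1 m1 b1 a2 m2 b2 a3 m3 b3 ->
  meet_triangle e12 e13 e23 tau a1 m1' b1 a2 m2' b2 a3 m3' b3 ->
  [/\ m1 = m1', m2 = m2' & m3 = m3'].
Proof.
rewrite /meet_triangle; case: k12 k13 k23 kinds => -[] [] //= _.
- exact: triangle_rel_inj.
- by case: tau e12 e13 e23 => -[] [] [] /= -[_ [? ?] [? ?]] [_ [? ?] [? ?]]; subst.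
- by case: tau e12 e13 e23 => -[] [] [] /= -[[? ?] _ [? ?]] [[? ?] _ [? ?]]; subst.
- by case: tau e12 e13 e23 => -[] [] [] /= -[[? ?] [? ?] _] [[? ?] [? ?] _]; subst.
- by case: tau e12 e13 e23 => -[] [] [] /= -[[? ?] [? ?] [? ?]] [[? ?] [? ?] [? ?]]; subst.
Qed.
End Cube.

(** * The curl of move I *)

Section Loop.
Variable X : finMCBiquandleType.

(** On the diagonal the first axiom makes both components of S equal to [under Single x x], so
    injectivity of S suffices. *)
Lemma under_diag_inj : injective (fun x : X => under Single x x).
Proof.
move=> x y /= e.
by have [] := @S_inj X Single x x y y _ e; rewrite // !mcb_diag.
Qed.

Definition loop_rel k e (first : bool) (a c b : X) : Prop :=
  if first then meet_rel k Single e (a, c) (c, b)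
  else meet_rel k Single e (c, b) (a, c).

(** At a classical crossing, the curl color [c] is either both arguments, and the first axiom
    applies, or both results. In the latter case S takes the pair of end colors to [(c, c)], which
    is also the image of a diagonal pair, so the ends agree. *)
Lemma loop_rel_ends k e first (a b c : X) : loop_rel k e first a c b -> a = b.
Proof.
have SxP (x y z : X) : z = over Single y x -> z = under Single x y -> x = y.
  have [g _ /(_ z) gz] := injF_bij under_diag_inj.
  rewrite -{1}gz -{1}[under _ (g z) _]mcb_diag => eo.
  by rewrite -gz => eu; have [-> ->] := S_inj eo eu.
case: k; last by case: first => -[/= -> ->].
case: first.
- by case: e => -[/= eu eo]; [rewrite eu eo mcb_diag | apply/esym/(SxP _ _ c)].
- by case: e => -[/= eu eo]; [apply: (SxP _ _ c) | rewrite eu eo mcb_diag].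
Qed.

(** A classical crossing with equal ends says either [a = under Single c c] or
    [c = under Single a a]; both can be solved for [c]. *)
Lemma loop_rel_ex k e first (a : X) : exists c, loop_rel k e first a c a.
Proof.
case: k; last by exists a; case: first.
have [g _ /(_ a)/= ga] := injF_bij under_diag_inj.
case: first; case: e.
- by exists (g a); split; rewrite /= ?mcb_diag.
- by exists (under Single a a); split; rewrite /= ?mcb_diag.
- by exists (under Single a a); split; rewrite /= ?mcb_diag.
- by exists (g a); split; rewrite /= ?mcb_diag.
Qed.

Lemma loop_rel_inj k e first (a b c c' : X) :
  loop_rel k e first a c b -> loop_rel k e first a c' b -> c = c'.
Proof.
move=> Lc; have eab := loop_rel_ends Lc; move: Lc; rewrite -{}eab.
case: k; last by case: first => -[/= ? ?] [/= ? ?]; congruence.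
case: first.
- case: e => -[/= eu eo] [/= eu' eo'].
    by apply: under_diag_inj; rewrite /= -eu.
  by rewrite eo eo'.
- case: e => -[/= eu eo] [/= eu' eo'].
    by rewrite eo eo'.
  by apply: under_diag_inj; rewrite /= -eu.
Qed.

End Loop.

(** * The bigon of move II *)

Section Bigon.
Variables (X : finMCBiquandleType) (k : flavor) (l : ctype) (e parallel : bool).

Definition bigon_rel (a m b c n d : X) : Prop :=
  meet_rel k l e (a, m) (halfv parallel c n d) /\
  meet_rel k l (~~ e) (m, b) (halfv (~~ parallel) c n d).

(** From the first crossing to the second, the sign and the halves of both strands are reversed
    together. Hence both crossings show the same corner relation at the inner colors [m] and [n]. *)
Lemma bigon_relE a m b c n d : k = classical ->
  bigon_rel a m b c n d <->
  corner_rel l (~~ e) (e == parallel) m a n (if parallel then c else d) /\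
  corner_rel l (~~ e) (e == parallel) m b n (if parallel then d else c).
Proof.
rewrite /bigon_rel /meet_rel => ->.
rewrite -[(a, m)]/(halfv true a m b) -[(m, b)]/(halfv false a m b).
by rewrite !cross_relE; case: e; case: parallel.
Qed.

Lemma bigon_rel_ends a m b c n d : bigon_rel a m b c n d -> a = b /\ c = d.
Proof.
case ek: k.
  move=> /(bigon_relE _ _ _ _ _ _ ek)[T /(corner_rel_inj T)[->]].
  by case: parallel.
by rewrite /bigon_rel ek; case: parallel => -[[/= -> ->] [-> ->]].
Qed.

Lemma bigon_rel_ex a c : exists m n, bigon_rel a m a c n c.
Proof.
case ek: k; last by exists a, c; rewrite /bigon_rel ek; case: parallel.
(* The crossing is solved from its outer corner, whose bits are the negations of those of the inner
   one. With equal ends one solution serves both crossings. *)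
have [m [n T]] := corner_rel_ex l (~~ (~~ e)) (~~ (e == parallel)) a c.
exists m, n; apply/(bigon_relE _ _ _ _ _ _ ek).
by rewrite corner_rel_opp; case: parallel T.
Qed.

Lemma bigon_rel_inj a m b c n d m' n' :
  bigon_rel a m b c n d -> bigon_rel a m' b c n' d -> m = m' /\ n = n'.
Proof.
case ek: k.
  move=> /(bigon_relE _ _ _ _ _ _ ek)[T _] /(bigon_relE _ _ _ _ _ _ ek)[T' _].
  move: T T'; rewrite !(corner_rel_opp _ _ _ m) !(corner_rel_opp _ _ _ m').
  exact: corner_rel_inj.
rewrite /bigon_rel ek; case: parallel => -[[/= ? ?] [? ?]] [[? ?] [? ?]];
  split; congruence.
Qed.

End Bigon.

(** * Colorings by labels *)


Section Linked.
Implicit Types (D : code) (a b x y : nat).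

Lemma node_strands_sub D n : n \in D -> {subset node_strands n <= strands D}.
Proof. by move=> nD s sn; apply/flatten_mapP; exists n. Qed.

Lemma strand_labels D a b : well_formed D -> (a, b) \in strands D ->
  a \in labels D /\ b \in labels D.
Proof.
move=> /andP[_ /perm_mem ends] ab; split; first exact: (map_f fst ab).
by rewrite ends; exact: (map_f snd ab).
Qed.

(** Working on all natural numbers instead of [lab D] allows comparing codes with different sets of
    labels. *)
Definition linked D : nat -> nat -> Prop :=
  clos_refl_sym_trans _ (fun a b => (a, b) \in strands D).

Lemma linked_map D D' (f : nat -> nat) :
  (forall a b, (a, b) \in strands D -> linked D' (f a) (f b)) ->
  forall x y, linked D x y -> linked D' (f x) (f y).
Proof.
move=> DD' x y; elim=> [a b /DD' //|a|a b _|a b c _ ab _ bc].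
- exact: rst_refl.
- exact: rst_sym.
- exact: rst_trans ab bc.
Qed.

Lemma linked_connect D (x y : lab D) : well_formed D ->
  linked D (val x) (val y) <-> connect (@component_rel D) x y.
Proof.
move=> wf; split=> [xy|/connectP[p]].
  (* The alternative [a = b] is there because reflexivity also relates numbers that are not
     labels. *)
  suff: forall a b, linked D a b ->
      a = b \/ exists x y : lab D,
        [/\ val x = a, val y = b & connect (@component_rel D) x y].
    move=> /(_ _ _ xy)[/val_inj ->|[x' [y' [/val_inj-> /val_inj->]]]] //.
  move=> a b; elim=> [{}a {}b ab|{}a|{}a {}b _|{}a {}b c _ ab _ bc].
  - have [aD bD] := strand_labels wf ab; right.
    exists (SeqSub aD), (SeqSub bD); split=> //; apply: connect1.
    by rewrite /component_rel /sym_rel ab.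
  - by left.
  - case=> [->|[x' [y' [<- <- xy']]]]; [by left|right].
    by exists y', x'; split=> //; rewrite connect_sym_rel.
  - case: ab => [->//|[x1 [y1 [e1 e2 xy1]]]].
    case: bc => [<-|[x2 [y2 [e3 e4 xy2]]]]; first by right; exists x1, y1.
    right; exists x1, y2; split=> //; apply: connect_trans xy2.
    by have /val_inj <- : val y1 = val x2 by rewrite e2 e3.
elim: p x => [|z p IHp] x /=; first by move=> _ ->; exact: rst_refl.
case/andP=> xz pz ey; apply: rst_trans (IHp _ pz ey).
case/orP: xz => [xz|zx]; first exact: rst_step.
exact/rst_sym/rst_step.
Qed.

Definition type_at D a b : ctype :=
  if `[< linked D a b >] then Single else Multi.

Lemma crossing_typeE D (o u : lab D) : well_formed D ->
  crossing_type o u = type_at D (val o) (val u).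
Proof.
move=> wf; rewrite /crossing_type /type_at.
by congr (if _ then _ else _); apply/idP/asboolP => /(linked_connect _ _ wf).
Qed.

Lemma eq_type_at D D' a b a' b' :
  linked D a b <-> linked D' a' b' -> type_at D a b = type_at D' a' b'.
Proof.
by rewrite /type_at => e; congr (if _ then _ else _); exact: asbool_equiv_eq.
Qed.

Lemma type_at_linked D a b : linked D a b -> type_at D a b = Single.
Proof. by move=> ab; rewrite /type_at asboolT. Qed.

Lemma type_at_congr D a a' b b' : linked D a a' -> linked D b b' ->
  type_at D a b = type_at D a' b'.
Proof.
move=> aa' bb'; apply: eq_type_at; split=> ab.
  by apply: rst_trans bb'; apply: rst_trans ab; apply: rst_sym.
by apply: rst_trans (rst_sym _ _ _ _ bb'); apply: rst_trans ab.
Qed.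

(** Lying on the same component is transitive, so among three pairs of strands it never happens that
    exactly one is of type [Multi]. The triples excluded by [admissible] are precisely these. *)
Lemma admissible_type_at D a b c :
  admissible (type_at D b c) (type_at D a c) (type_at D a b).
Proof.
rewrite /type_at.
case: asboolP => bc; case: asboolP => ac; case: asboolP => ab //; exfalso.
- by apply: ab; apply: rst_trans ac (rst_sym _ _ _ _ bc).
- by apply: ac; apply: rst_trans ab bc.
- by apply: bc; apply: rst_trans (rst_sym _ _ _ _ ab) ac.
Qed.

End Linked.

(** * Colorings as functions on labels *)

Section Valid.
Variable X : mcBiquandleType.
Implicit Types (D : code) (c : nat -> X).

(** Colors are put on labels instead of semiarcs; the equations at markers and virtual crossings
    make them constant along each semiarc. *)
Definition node_rel (ty : nat -> nat -> ctype) c (n : node) : Prop :=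
  match n with
  | Marker a b => c a = c b
  | Crossing e o o' u u' => cross_rel (ty o u) e (c o, c o') (c u, c u')
  | Virtual a b a' b' => c a = c b /\ c a' = c b'
  end.

Definition valid D c : Prop :=
  forall n, n \in D -> node_rel (type_at D) c n.

Definition represents D (f : semiarc D -> X) c : Prop :=
  forall a : lab D, f (semiarc_of a) = c (val a).

Lemma connect_const (T : finType) (Y : Type) (e : rel T) (g : T -> Y) x y :
  (forall x y, e x y -> g x = g y) -> connect e x y -> g x = g y.
Proof.
move=> eg /connectP[p]; elim: p x => [|z p IHp] x /= => [_ -> //|].
by move=> /andP[/eg -> pz] /(IHp _ pz).
Qed.

Lemma semiarc_of_val D (s : semiarc D) : semiarc_of (val s) = s.
Proof. by apply/val_inj/eqP; exact: (valP s). Qed.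

Lemma eq_semiarc_of D (x y : lab D) n :
  n \in D -> (val x, val y) \in node_uncut n -> semiarc_of x = semiarc_of y.
Proof.
move=> nD xy; apply/val_inj/eqP.
rewrite (root_connect (@connect_sym_rel _ _)); apply: connect1.
by apply/orP; left; apply/hasP; exists n.
Qed.

Lemma coloring_valid D (f : semiarc D -> X) c : well_formed D ->
  represents f c -> is_coloring f <-> valid D c.
Proof.
move=> wf fc; split=> [fcol n nD|cval l x y x' y' [e [o [o' [u [u' [nD -> ]]]]]]].
  have lbl a b : (a, b) \in node_strands n -> a \in labels D /\ b \in labels D.
    by move=> /(node_strands_sub nD); exact: strand_labels.
  have uncut a b : (a, b) \in node_uncut n -> c a = c b.
    move=> ab; have [|aD bD] := lbl a b.
      by move: ab; rewrite /node_uncut; case: (n).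
    rewrite -[a]/(val (SeqSub aD)) -[b]/(val (SeqSub bD)) -!fc.
    by congr f; exact: (@eq_semiarc_of D (SeqSub aD) (SeqSub bD) n nD ab).
  case: n nD lbl uncut => [a b|e o o' u u'|a b a' b'] nD lbl uncut /=.
  - by apply: uncut; rewrite inE.
  - have [|oD o'D] := lbl o o'; first by rewrite inE eqxx.
    have [|uD u'D] := lbl u u'; first by rewrite !inE eqxx orbT.
    rewrite -[o]/(val (SeqSub oD)) -[u]/(val (SeqSub uD)).
    rewrite -[o']/(val (SeqSub o'D)) -[u']/(val (SeqSub u'D)).
    rewrite -crossing_typeE // -!fc.
    case: e nD {lbl uncut} => nD; apply: fcol.
    + by exists true, (SeqSub oD), (SeqSub o'D), (SeqSub uD), (SeqSub u'D).
    + by exists false, (SeqSub oD), (SeqSub o'D), (SeqSub uD), (SeqSub u'D).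
  - by split; apply: uncut; rewrite !inE eqxx ?orbT.
have := cval _ nD; rewrite /= -crossing_typeE // -!fc.
by case: e {nD} => /= -[eu eo] [-> -> -> ->].
Qed.

Lemma valid_represents D c : valid D c ->
  exists f : {ffun semiarc D -> X}, represents f c.
Proof.
move=> cval; exists [ffun s : semiarc D => c (val (val s))] => a.
rewrite ffunE /=; apply/esym.
apply: (@connect_const _ _ (@uncut_rel D) (fun a => c (val a))); last first.
  exact: connect_root.
have step (x y : lab D) :
    has (fun n => (val x, val y) \in node_uncut n) D -> c (val x) = c (val y).
  move=> /hasP[n /cval]; case: n => //= [a' b'|a1 b1 a2 b2] ok.
    by rewrite inE => /eqP[-> ->].
  by rewrite !inE => /orP[] /eqP[-> ->]; case: ok.
by move=> x y /orP[/step|/step].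
Qed.

Lemma represents_inj D (f g : {ffun semiarc D -> X}) c d :
  represents f c -> represents g d -> {in labels D, c =1 d} -> f = g.
Proof.
move=> fc gd cd; apply/ffunP => s; rewrite -(semiarc_of_val s) fc gd.
by apply: cd; exact: (valP (val s)).
Qed.

End Valid.

(** * Comparison of numbers of colorings *)

Section Count.
Variable X : finMCBiquandleType.

(** Choice extracts from [R] a function into [Q], which the second hypothesis makes injective. *)
Lemma leq_card_rel (A B : finType) (P : pred A) (Q : pred B)
    (R : A -> B -> Prop) :
  (forall a, P a -> exists2 b, Q b & R a b) ->
  (forall a a' b, P a -> P a' -> R a b -> R a' b -> a = a') ->
  #|P| <= #|Q|.
Proof.
move=> tot inj; have eP (T : finType) (S : pred T) : #|S| = #|{: {x | S x}}|.
  by rewrite card_sig; exact: eq_card.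
rewrite (eP A) (eP B).
pose h (s : {a | P a}) := cid2 (tot _ (valP s)).
pose g s : {b | Q b} := exist _ (s2val (h s)) (s2valP (h s)).
apply: (@leq_card _ _ g) => s s' [] ess'; apply/val_inj.
apply: inj (valP s) (valP s') (s2valP' (h s)) _.
by rewrite ess'; exact: (s2valP' (h s')).
Qed.

(** The relation [R] says how a coloring of one code is carried to the other. The last hypothesis
    makes this injective up to values outside the labels, which a coloring of semiarcs does not
    see. *)
Lemma leq_num_colorings (D D' : code) (R : (nat -> X) -> (nat -> X) -> Prop) :
  well_formed D -> well_formed D' -> D != [::] ->
  (forall c, valid D c -> exists2 c', valid D' c' & R c c') ->
  (forall c d c' d', valid D c -> valid D d -> R c c' -> R d d' ->
     {in labels D', c' =1 d'} -> {in labels D, c =1 d}) ->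
  num_colorings D X <= num_colorings D' X.
Proof.
move=> wf wf' D0 tot inj.
(* The color of some label serves as default value outside the labels, since [X] comes without a
   distinguished element. *)
have [a] : exists a, a \in labels D.
  case: (D) D0 => // n K _; exists (head 0 (labels (n :: K))).
  by case: n => *; rewrite inE eqxx.
move=> aD; pose x0 (f : {ffun semiarc D -> X}) := f (semiarc_of (SeqSub aD)).
pose ext (f : {ffun semiarc D -> X}) n :=
  if (insub n : option (lab D)) is Some b then f (semiarc_of b) else x0 f.
have extP (f : {ffun semiarc D -> X}) : represents f (ext f).
  by move=> b; rewrite /ext valK.
rewrite /num_colorings; apply: (@leq_card_rel _ _ _ _
  (fun (f : {ffun semiarc D -> X}) (f' : {ffun semiarc D' -> X}) =>
  exists c c', [/\ valid D c, represents f c, represents f' c' & R c c'])).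
- move=> f; rewrite inE => /asboolP/(coloring_valid wf (extP f)) fval.
  have [c' c'val Rcc'] := tot _ fval.
  have [f' f'c'] := valid_represents c'val.
  exists f'; first by rewrite inE; apply/asboolP/(coloring_valid wf' f'c').
  by exists (ext f), c'.
- move=> f g f' _ _ [c [c' [cval fc f'c' Rcc']]] [d [d' [dval gd f'd' Rdd']]].
  apply: (represents_inj fc gd).
  apply: (inj _ _ _ _ cval dval Rcc' Rdd') => b bD'.
  by have := f'd' (SeqSub bD'); rewrite f'c'.
Qed.

End Count.

(** * Relabelling and markers *)


Section Steps.
Variable X : finMCBiquandleType.
Implicit Types (D K L R : code) (c d : nat -> X).

Notation ends D := (unzip2 (strands D)).

Lemma eq_node_rel ty ty' c d n :
  {in unzip1 (node_strands n) &, ty =2 ty'} ->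
  {in node_ends n, c =1 d} -> node_rel ty c n -> node_rel ty' d n.
Proof.
case: n => [a b|e a b a' b'|a b a' b'] /= ety ecd.
- by rewrite !ecd // !inE eqxx ?orbT.
- by rewrite !ecd ?ety // !inE eqxx ?orbT.
- by rewrite !ecd // !inE eqxx ?orbT.
Qed.

Lemma node_ends_labels D n : well_formed D -> n \in D ->
  {subset node_ends n <= labels D}.
Proof.
move=> wf nD x; rewrite mem_cat => /orP[] /mapP[[a b] /(node_strands_sub nD)].
  by move=> /(strand_labels wf)[aD _] ->.
by move=> /(strand_labels wf)[_ bD] ->.
Qed.

Lemma node_starts_ends n : {subset unzip1 (node_strands n) <= node_ends n}.
Proof. by move=> x; rewrite mem_cat => ->. Qed.

Lemma strands_cat D D' : strands (D ++ D') = strands D ++ strands D'.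
Proof. by rewrite /strands map_cat flatten_cat. Qed.

Lemma strands_relabel f D :
  strands (relabel f D) = [seq (f s.1, f s.2) | s <- strands D].
Proof.
elim: D => // n D IHD; rewrite -cat1s /relabel map_cat !strands_cat map_cat.
by rewrite -/(relabel f D) IHD; case: n.
Qed.

Lemma labels_relabel f D : labels (relabel f D) = map f (labels D).
Proof. by rewrite /labels strands_relabel /unzip1 -!map_comp. Qed.

Lemma relabel_comp f g D : relabel f (relabel g D) = relabel (f \o g) D.
Proof. by rewrite /relabel -map_comp; apply: eq_map; case. Qed.

Lemma relabel_id f D : well_formed D -> {in labels D, f =1 id} -> relabel f D = D.
Proof.
move=> wf fid; rewrite -[RHS]map_id; apply/eq_in_map => n nD.
have {}fid : {in node_ends n, f =1 id} by move=> x /(node_ends_labels wf nD)/fid.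
by case: n {nD} fid => [a b|e a b c d|a b c d] fid /=;
  rewrite !fid // /node_ends /= !inE eqxx ?orbT.
Qed.

Lemma valid_relabel D f c :
  well_formed D -> {in labels D &, forall a b,
    type_at (relabel f D) (f a) (f b) = type_at D a b} ->
  valid (relabel f D) c <-> valid D (c \o f).
Proof.
move=> wf ety.
have eqv n : n \in D ->
    node_rel (type_at (relabel f D)) c (relabel_node f n) <->
    node_rel (type_at D) (c \o f) n.
  case: n => //= e a b a' b' nD; rewrite ety //;
  by apply: (node_ends_labels wf nD); rewrite /node_ends /= !inE eqxx ?orbT.
split=> cval n; first by move=> nD; apply/(eqv _ nD)/cval/map_f.
by move=> /mapP[n0 nD ->]; apply/(eqv _ nD)/cval.
Qed.

Lemma inj_in_cancel (s : seq nat) (f : nat -> nat) : {in s &, injective f} ->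
  exists g, {in s, cancel f g}.
Proof.
move=> finj; exists (fun y => nth 0 s (index y (map f s))) => a aD.
have lt_s : index (f a) (map f s) < size s.
  by rewrite -(size_map f) index_mem map_f.
by apply: finj => //; rewrite ?mem_nth // -(nth_map 0 0 f lt_s) nth_index ?map_f.
Qed.

Lemma leq_num_colorings_relabel D f :
  well_formed D -> well_formed (relabel f D) -> D != [::] ->
  {in labels D &, injective f} ->
  num_colorings (relabel f D) X <= num_colorings D X.
Proof.
move=> wf wf' D0 finj.
have [g gK] := inj_in_cancel finj.
apply: (@leq_num_colorings _ _ _ (fun c c' => c' = c \o f)) => //.
- by case: D {wf wf' finj g gK} D0.
- move=> c cval; exists (c \o f) => //.
  (* Crossing types agree because [f] carries strands to strands and [g] carries them back. *)
  move: cval; rewrite valid_relabel // => a b aD bD; apply: eq_type_at; split.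
  + move=> ab; rewrite -(gK a) // -(gK b) //; move: ab.
    apply: linked_map => x y; rewrite strands_relabel.
    case/mapP=> -[x' y'] xy [-> ->] /=; have [xD yD] := strand_labels wf xy.
    by rewrite !gK //; exact: rst_step.
  + apply: linked_map => x y xy; apply: rst_step.
    by rewrite strands_relabel; exact: (map_f (fun s => (f s.1, f s.2)) xy).
- move=> c d _ _ _ _ -> -> ecd x; rewrite labels_relabel => /mapP[y yD ->].
  exact: ecd.
Qed.

Lemma num_colorings_relabel D f :
  well_formed D -> well_formed (relabel f D) -> {in labels D &, injective f} ->
  num_colorings (relabel f D) X = num_colorings D X.
Proof.
move=> wf wf' finj.
have [->//|D0] := eqVneq D [::].
apply/eqP; rewrite eqn_leq leq_num_colorings_relabel //=.
have [g gK] := inj_in_cancel finj.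
have gD : relabel g (relabel f D) = D.
  by rewrite relabel_comp relabel_id // => a /gK.
rewrite -{1}gD leq_num_colorings_relabel ?gD //.
  by case: (D) D0.
move=> x y; rewrite labels_relabel => /mapP[a aD ->] /mapP[b bD ->].
by rewrite !gK // => ->.
Qed.

Lemma leq_num_colorings_perm D D' :
  well_formed D -> well_formed D' -> D != [::] -> perm_eq D D' ->
  num_colorings D X <= num_colorings D' X.
Proof.
move=> wf wf' D0 DD'.
have est : strands D =i strands D'.
  by apply: perm_mem; apply: perm_flatten; exact: perm_map.
have elb : labels D =i labels D' by exact: eq_mem_map.
apply: (@leq_num_colorings _ _ _ (fun c c' => c = c')) => //.
- move=> c cval; exists c => // n; rewrite -(perm_mem DD') => /cval.
  apply: eq_node_rel => // a b _ _; apply: eq_type_at.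
  by split; apply: (@linked_map _ _ id) => x y xy; apply: rst_step;
    rewrite ?est // -est.
- by move=> c d _ _ _ _ <- <- ecd x; rewrite elb => /ecd.
Qed.

(** Removing the marker merges [b] into [a]. Every label is linked to its image under [f], so
    components persist, and the marker forces the merged labels to share their color. *)
Lemma num_colorings_marker a b K : a != b ->
  let f x := if x == b then a else x in
  well_formed (Marker a b :: K) -> well_formed (relabel f K) ->
  num_colorings (Marker a b :: K) X = num_colorings (relabel f K) X.
Proof.
move=> ab f wf wf'; set D := Marker a b :: K in wf *.
have fb : f b = a by rewrite /f eqxx.
have fa : f a = a by rewrite /f (negPf ab).
have fK x : x != b -> f x = x by rewrite /f => /negPf ->.
have linkf x : linked D x (f x).
  have [->|/fK->] := eqVneq x b; last exact: rst_refl.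
  by rewrite fb; apply/rst_sym/rst_step; rewrite inE eqxx.
have ety x y : type_at (relabel f K) (f x) (f y) = type_at D x y.
  apply: eq_type_at; split=> xy.
    apply: rst_trans (rst_sym _ _ _ _ (linkf y)).
    apply: rst_trans (linkf x) _; rewrite -/(linked _ _ _).
    apply: (@linked_map _ _ id) xy => u v; rewrite strands_relabel.
    case/mapP=> -[u' v'] uv [-> ->] /=; apply: rst_trans (linkf v').
    apply: rst_trans (rst_sym _ _ _ _ (linkf u')) _.
    by apply: rst_step; rewrite inE uv orbT.
  apply: linked_map xy => u v; rewrite inE => /orP[/eqP[-> ->]|uv].
    by rewrite fa fb; exact: rst_refl.
  apply: rst_step; rewrite strands_relabel.
  exact: (map_f (fun s => (f s.1, f s.2)) uv).
have eqv c n : node_rel (type_at (relabel f K)) c (relabel_node f n) <->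
    node_rel (type_at D) (c \o f) n.
  by case: n => //= e o o' u u'; rewrite ety.
(* The label [b] starts somewhere, and not at the marker since it differs from [a]; in particular
   [K] is not empty. *)
have bK : b \in labels K.
  have := strand_labels wf (_ : (a, b) \in strands D); rewrite inE eqxx.
  by case=> // _; rewrite inE eq_sym (negPf ab).
have aK : a \in labels (relabel f K).
  by rewrite labels_relabel -fb map_f.
apply/eqP; rewrite eqn_leq; apply/andP; split.
- apply: (@leq_num_colorings _ _ _ (fun c c' => c = c')) => //.
    move=> c cval; exists c => // _ /mapP[n nK ->]; apply/eqv.
    apply: eq_node_rel (cval n _) => //; last by rewrite inE nK orbT.
    move=> x _ /=; have [->|/fK->//] := eqVneq x b.
    by rewrite fb; apply/esym/(cval (Marker a b)); rewrite inE eqxx.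
  move=> c d _ _ cval dval <- <- ecd x xD.
  have cdf : c (f x) = d (f x).
    move: xD; rewrite inE => /orP[/eqP->|xK]; first by rewrite fa ecd.
    by apply: ecd; rewrite labels_relabel map_f.
  have [eb|/fK fx] := eqVneq x b; last by rewrite -fx.
  have mk : Marker a b \in D by rewrite inE eqxx.
  by rewrite eb -(cval _ mk) -(dval _ mk) ecd.
- apply: (@leq_num_colorings _ _ _ (fun c c' => c' = c \o f)) => //.
  + by case: (K) bK.
  + move=> c cval; exists (c \o f) => // n; rewrite inE => /orP[/eqP->|nK] /=.
      by rewrite fa fb.
    by apply/eqv/cval/map_f.
  + move=> c d _ _ _ _ -> -> ecd x; rewrite labels_relabel => /mapP[y yK ->].
    by apply: ecd; rewrite inE yK orbT.
Qed.

End Steps.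

(** * Local moves *)


Section Local.
Variable X : finMCBiquandleType.
Implicit Types (D K L R : code) (c d : nat -> X).

Notation ends D := (unzip2 (strands D)).

Lemma labels_cat D D' : labels (D ++ D') = labels D ++ labels D'.
Proof. by rewrite /labels strands_cat /unzip1 map_cat. Qed.

Lemma mem_node_ends D n : n \in D ->
  {subset node_ends n <= labels D ++ ends D}.
Proof.
move=> nD x; rewrite !mem_cat => /orP[] /mapP[s /(node_strands_sub nD) sD ->].
  by rewrite [_ \in labels D]map_f.
by rewrite [_ \in ends D]map_f ?orbT.
Qed.

Lemma linked_cat D L K : {subset K <= D} ->
  (forall a b, (a, b) \in strands L -> linked D a b) ->
  forall x y, linked (L ++ K) x y -> linked D x y.
Proof.
move=> KD LD; apply: (@linked_map _ _ id) => a b.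
rewrite strands_cat mem_cat => /orP[/LD//|].
case/flatten_mapP=> n /KD nD ab; apply: rst_step.
exact: node_strands_sub ab.
Qed.

Definition rels_at D L c := forall n, n \in L -> node_rel (type_at D) c n.

(* [I] contains the labels interior to the two sides of a local move. *)
Lemma leq_num_colorings_local L R K (I : seq nat) :
  well_formed (L ++ K) -> well_formed (R ++ K) -> L != [::] ->
  {in I, forall x, x \notin labels K ++ ends K} ->
  {in labels L, forall x, x \notin I -> x \in labels (R ++ K)} ->
  (forall x y, x \notin I -> y \notin I ->
     linked (L ++ K) x y <-> linked (R ++ K) x y) ->
  (forall c, rels_at (L ++ K) L c -> exists2 c',
     rels_at (R ++ K) R c' & forall x, x \notin I -> c x = c' x) ->
  (forall c d, rels_at (L ++ K) L c -> rels_at (L ++ K) L d ->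
     {in labels (L ++ K), forall x, x \notin I -> c x = d x} ->
     {in I, forall x, x \in labels L -> c x = d x}) ->
  num_colorings (L ++ K) X <= num_colorings (R ++ K) X.
Proof.
move=> wf wf' L0 IK LI linkE ext inj.
(* Nodes outside the move meet no interior label, so recoloring the interior leaves their relations
   intact. *)
have KI n : n \in K -> {in node_ends n, forall x, x \notin I}.
  move=> nK x /(mem_node_ends nK); apply: contraL => /IK.
  by rewrite mem_cat.
have sub D D' c : valid (D ++ D') c -> rels_at (D ++ D') D c.
  by move=> cval n nD; apply: cval; rewrite mem_cat nD.
apply: (@leq_num_colorings _ _ _
  (fun c c' => forall x, x \notin I -> c x = c' x)) => //.
- by case: (L) L0.
- move=> c cval; have [c' c'R ec] := ext c (sub _ _ _ cval).
  exists c' => // n; rewrite mem_cat => /orP[/c'R//|nK].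
  apply: eq_node_rel (cval n _); last by rewrite mem_cat nK orbT.
  + move=> a b /node_starts_ends/(KI _ nK) aI /node_starts_ends/(KI _ nK) bI.
    exact/eq_type_at/linkE.
  + by move=> x /(KI _ nK)/ec.
- move=> c d c' d' cval dval ec ed ec'd'.
  have ecd : {in labels (L ++ K), forall x, x \notin I -> c x = d x}.
    move=> x xD xI; rewrite ec // ed // ec'd' //.
    move: xD; rewrite labels_cat mem_cat => /orP[/LI->//|xK].
    by rewrite labels_cat mem_cat xK orbT.
  move=> x xD; have [xI|/ecd->//] := boolP (x \in I).
  apply: (inj _ _ (sub _ _ _ cval) (sub _ _ _ dval) ecd _ xI).
  move: xD; rewrite labels_cat mem_cat => /orP[//|xK].
  by have := IK _ xI; rewrite mem_cat xK.
Qed.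

Lemma strands_meet k e p q : perm_eq (node_strands (meet k e p q)) [:: p; q].
Proof.
by case: k e p q => -[] [a b] [a' b'] //=; rewrite -cat1s perm_catC.
Qed.

Lemma node_rel_meet ty c k e p q :
  node_rel ty c (meet k e p q) <->
  meet_rel k (ty p.1 q.1) e (c p.1, c p.2) (c q.1, c q.2).
Proof. by case: k e => -[] //=; split=> -[]. Qed.

Lemma well_formed_strands D (s : seq (nat * nat)) : perm_eq (strands D) s ->
  well_formed D -> uniq (unzip1 s) /\ uniq (unzip2 s).
Proof.
move=> Ds /andP[uD eD].
rewrite -(perm_uniq (perm_map fst Ds)) -(perm_uniq (perm_map snd Ds)).
by rewrite -(perm_uniq eD).
Qed.

(** * Invariance under move I *)

Section Loop.
Variables (k : flavor) (e : bool) (a b c0 : nat) (first : bool) (K : code).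

Definition loop_node :=
  if first then meet k e (a, c0) (c0, b) else meet k e (c0, b) (a, c0).

Let D := [:: Marker a b] ++ K.
Let D' := [:: loop_node] ++ K.
Hypotheses (wf : well_formed D) (wf' : well_formed D').

Lemma strands_loop : perm_eq (strands D') [:: (a, c0), (c0, b) & strands K].
Proof.
rewrite -[strands D']/(node_strands loop_node ++ strands K).
rewrite -[_ :: _ :: _]/([:: (a, c0); (c0, b)] ++ _) perm_cat2r.
rewrite /loop_node; case: first; first exact: strands_meet.
by apply: perm_trans (strands_meet _ _ _ _) _; rewrite -cat1s perm_catC.
Qed.

Lemma node_rel_loop E c : linked E a c0 ->
  node_rel (type_at E) c loop_node <-> loop_rel k e first (c a) (c c0) (c b).
Proof.
move=> ac; rewrite /loop_node /loop_rel; case: first; rewrite node_rel_meet /=.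
  by rewrite type_at_linked.
by rewrite type_at_linked //; exact: rst_sym.
Qed.

Lemma num_colorings_loop : num_colorings D X = num_colorings D' X.
Proof.
have [/= uL uE] := well_formed_strands strands_loop wf'.
have st s : s \in strands D' = (s \in [:: (a, c0), (c0, b) & strands K]).
  exact: perm_mem strands_loop s.
have lb x : x \in labels D' = (x \in [:: a, c0 & labels K]).
  exact: perm_mem (perm_map fst strands_loop) x.
move: uL uE; rewrite !inE !negb_or => /andP[/andP[ac aK] /andP[cK _]].
move=> /andP[/andP[cb cE] _].
have ca : (a == c0) = false by exact: negbTE.
have cbF : (b == c0) = false by rewrite eq_sym; exact: negbTE.
have link_ac : linked D' a c0 by apply: rst_step; rewrite st inE eqxx.
have link_cb : linked D' c0 b by apply: rst_step; rewrite st !inE eqxx orbT.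
have linkE x y : x \notin [:: c0] -> y \notin [:: c0] ->
    linked D x y <-> linked D' x y.
  rewrite !inE => xc yc; split.
    apply: linked_cat => [n nK|_ _ /[!inE]/eqP[-> ->]].
      by rewrite mem_cat nK orbT.
    exact: rst_trans link_ac link_cb.
  (* Contracting the curl collapses its first strand to a point and turns its second one into the
     marker. *)
  pose f z := if z == c0 then a else z.
  have fE z : z != c0 -> f z = z by rewrite /f => /negPf->.
  rewrite -{2}(fE _ xc) -{2}(fE _ yc); apply: linked_map => u v.
  rewrite st !inE => /or3P[/eqP[-> ->]|/eqP[-> ->]|uv].
  - by rewrite /f ca eqxx; exact: rst_refl.
  - by rewrite /f cbF eqxx; apply: rst_step; rewrite inE eqxx.
  - rewrite !fE; first by apply: rst_step; rewrite inE uv orbT.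
      by apply: contraNneq cE => <-; exact: (map_f snd uv).
    by apply: contraNneq cK => <-; exact: (map_f fst uv).
have fresh : {in [:: c0], forall x, x \notin labels K ++ ends K}.
  by move=> x; rewrite inE => /eqP->; rewrite mem_cat negb_or cK.
have bD : b \in labels D.
  have := strand_labels wf (_ : (a, b) \in strands D); rewrite inE eqxx.
  by case.
apply/eqP; rewrite eqn_leq; apply/andP; split.
- apply: leq_num_colorings_local fresh _ linkE _ _ => //.
  + by move=> x; rewrite inE => /eqP-> _; rewrite -/D' lb inE eqxx.
  + move=> c /(_ (Marker a b)); rewrite inE eqxx => /(_ isT)/= cab.
    have [z zL] := loop_rel_ex k e first (c a).
    exists [eta c with c0 |-> z] => [n|x]; rewrite inE; last by move=> /negPf/= ->.
    move=> /eqP->; apply/(node_rel_loop _ link_ac).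
    by rewrite /= ca cbF eqxx -cab.
  + by move=> c d _ _ _ x; rewrite !inE => /eqP-> /=; rewrite eq_sym ca.
(* Removing the curl: its ends have equal colors, as the marker requires, and they determine the
   color of [c0]. *)
- apply: leq_num_colorings_local fresh _ _ _ _ => //.
  + move=> x xL; rewrite inE => xc; rewrite -/D labels_cat mem_cat.
    have : x \in labels D' by rewrite labels_cat mem_cat xL.
    by rewrite lb !inE (negPf xc).
  + by move=> x y xI yI; rewrite linkE.
  + move=> c /(_ loop_node); rewrite inE eqxx => /(_ isT).
    move=> /(node_rel_loop _ link_ac)/loop_rel_ends cab.
    by exists c => // n; rewrite inE => /eqP->.
  + move=> c d /(_ loop_node)+ /(_ loop_node).
    rewrite inE eqxx => /(_ isT)/(node_rel_loop _ link_ac) cL.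
    move=> /(_ isT)/(node_rel_loop _ link_ac) dL ecd x; rewrite inE => /eqP-> _.
    move: cL dL; rewrite -ecd ?lb ?inE ?eqxx ?ca //.
    rewrite -(ecd b) ?inE ?cbF //; first exact: loop_rel_inj.
    by move: bD; rewrite lb !inE => /orP[->|->]; rewrite ?orbT.
Qed.

End Loop.

Lemma half_rel c f a m b : (c (half f a m b).1, c (half f a m b).2) =
  halfv f (c a) (c m) (c b).
Proof. by case: f. Qed.

Lemma perm_halves f a m b : perm_eq [:: half f a m b; half (~~ f) a m b]
  [:: (a, m); (m, b)].
Proof. by case: f => //; rewrite -cat1s perm_catC. Qed.

(** * Invariance under move II *)

Section Bigon.
Variables (k : flavor) (e : bool) (a1 m1 b1 a2 m2 b2 : nat) (parallel : bool).
Variable K : code.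

Definition bigon_nodes :=
  [:: meet k e (a1, m1) (half parallel a2 m2 b2);
      meet k (~~ e) (m1, b1) (half (~~ parallel) a2 m2 b2)].

Let D := [:: Marker a1 b1; Marker a2 b2] ++ K.
Let D' := bigon_nodes ++ K.
Hypotheses (wf : well_formed D) (wf' : well_formed D').

Lemma strands_bigon : perm_eq (strands D')
  [:: (a1, m1), (m1, b1), (a2, m2), (m2, b2) & strands K].
Proof.
rewrite strands_cat.
rewrite -[_ :: _]/([:: (a1, m1); (m1, b1); (a2, m2); (m2, b2)] ++ _) perm_cat2r.
rewrite -[strands _]/(node_strands _ ++ node_strands _ ++ [::]) cats0.
apply: perm_trans (perm_cat (strands_meet _ _ _ _) (strands_meet _ _ _ _)) _.
rewrite /= perm_cons.
apply: perm_trans (permEl (perm_catCA [:: _] [:: _] [:: _])) _.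
by rewrite /= perm_cons perm_halves.
Qed.

(** Each strand stays in one component, so both crossings have the type read off at [a1] and
    [a2]. *)
Lemma rels_bigon E c : linked E a1 m1 -> linked E a2 m2 ->
  rels_at E bigon_nodes c <-> bigon_rel k (type_at E a1 a2) e parallel
    (c a1) (c m1) (c b1) (c a2) (c m2) (c b2).
Proof.
move=> l1 l2; have l f : linked E a2 (half f a2 m2 b2).1.
  by case: f => //; exact: rst_refl.
have n1 := node_rel_meet (type_at E) c k e (a1, m1) (half parallel a2 m2 b2).
have n2 := node_rel_meet (type_at E) c k (~~ e) (m1, b1)
  (half (~~ parallel) a2 m2 b2).
rewrite !half_rel /= in n1 n2.
rewrite -(type_at_congr (rst_refl _ _ _) (l _)) in n1.
rewrite -(type_at_congr l1 (l _)) in n2.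
split=> [ok|[r1 r2] n].
  by split; [apply/n1/ok | apply/n2/ok]; rewrite !inE eqxx ?orbT.
by rewrite !inE => /orP[] /eqP->; [apply/n1 | apply/n2].
Qed.

Lemma num_colorings_bigon : num_colorings D X = num_colorings D' X.
Proof.
have [/= uL uE] := well_formed_strands strands_bigon wf'.
have st s : s \in strands D' =
    (s \in [:: (a1, m1), (m1, b1), (a2, m2), (m2, b2) & strands K]).
  exact: perm_mem strands_bigon s.
have lb x : x \in labels D' = (x \in [:: a1, m1, a2, m2 & labels K]).
  exact: perm_mem (perm_map fst strands_bigon) x.
pose I := [:: m1; m2].
have [m12 [a1I a2I b1I b2I] [IL IE]] : [/\ m2 != m1,
    [/\ a1 \notin I, a2 \notin I, b1 \notin I & b2 \notin I] &
    {in I, forall x, x \notin labels K} /\ {in I, forall x, x \notin ends K}].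
  (* Distinctness of the starts separates the interior labels from [a1], [a2] and the starts in [K];
     distinctness of the ends separates them from [b1], [b2] and the ends in [K]. *)
  move: uL uE; rewrite /= !inE !negb_or -!andbA.
  do 10 case/andP=> ?; move=> _; do 10 case/andP=> ?; move=> _.
  split; first by rewrite eq_sym.
  - by split; apply/andP; split; rewrite // eq_sym.
  - by split=> x; rewrite !inE => /orP[] /eqP->.
have link_a1 : linked D' a1 m1 by apply: rst_step; rewrite st inE eqxx.
have link_a2 : linked D' a2 m2 by apply: rst_step; rewrite st !inE eqxx !orbT.
have linkE x y : x \notin I -> y \notin I -> linked D x y <-> linked D' x y.
  move=> xI yI; split.
    apply: linked_cat => [n nK|u v]; first by rewrite mem_cat nK orbT.
    rewrite !inE => /orP[] /eqP[-> ->].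
      by apply: rst_trans link_a1 _; apply: rst_step; rewrite st !inE eqxx orbT.
    by apply: rst_trans link_a2 _; apply: rst_step; rewrite st !inE eqxx !orbT.
  (* Contracting the first half of each strand turns the second half into a marker. *)
  pose f z := if z == m1 then a1 else if z == m2 then a2 else z.
  have fE z : z \notin I -> f z = z.
    by rewrite !inE negb_or /f => /andP[/negPf-> /negPf->].
  have fm1 : f m1 = a1 by rewrite /f eqxx.
  have fm2 : f m2 = a2 by rewrite /f (negPf m12) eqxx.
  rewrite -{2}(fE _ xI) -{2}(fE _ yI); apply: linked_map => u v.
  rewrite st 4!inE => /or4P[/eqP[-> ->]|/eqP[-> ->]|/eqP[-> ->]|/orP[/eqP[-> ->]|uv]].
  - by rewrite fm1 fE //; exact: rst_refl.
  - by rewrite fm1 fE //; apply: rst_step; rewrite !inE eqxx.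
  - by rewrite fm2 fE //; exact: rst_refl.
  - by rewrite fm2 fE //; apply: rst_step; rewrite !inE eqxx orbT.
  - rewrite !fE; first by apply: rst_step; rewrite !inE uv !orbT.
      by apply: contraL (map_f snd uv) => /IE.
    by apply: contraL (map_f fst uv) => /IL.
have fresh : {in I, forall x, x \notin labels K ++ ends K}.
  by move=> x xI; rewrite mem_cat negb_or IL // IE.
have b1D : b1 \in labels D'.
  by have [] := strand_labels wf' (_ : (m1, b1) \in _);
    rewrite // st !inE eqxx orbT.
have b2D : b2 \in labels D'.
  by have [] := strand_labels wf' (_ : (m2, b2) \in _);
    rewrite // st !inE eqxx !orbT.
apply/eqP; rewrite eqn_leq; apply/andP; split.
- apply: leq_num_colorings_local fresh _ linkE _ _ => //.
  + by move=> x; rewrite !inE => /orP[] /eqP-> _; rewrite -/D' lb !inE eqxx ?orbT.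
  + move=> c ok; have := ok (Marker a1 b1); rewrite inE eqxx => /(_ isT)/= c1.
    have := ok (Marker a2 b2); rewrite !inE eqxx orbT => /(_ isT)/= c2.
    have [z1 [z2 zb]] :=
      bigon_rel_ex k (type_at D' a1 a2) e parallel (c a1) (c a2).
    pose c' := [eta c with m1 |-> z1, m2 |-> z2].
    have c'E x : x \notin I -> c x = c' x.
      by rewrite !inE negb_or /c' /= => /andP[/negPf-> /negPf->].
    exists c' => //; apply/(rels_bigon _ link_a1 link_a2).
    have c'm1 : c' m1 = z1 by rewrite /c' /= eqxx.
    have c'm2 : c' m2 = z2 by rewrite /c' /= (negPf m12) eqxx.
    rewrite c'm1 c'm2 -(c'E a1) // -(c'E a2) // -(c'E b1) // -(c'E b2) //.
    by rewrite -c1 -c2.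
  + move=> c d _ _ _ x xI; rewrite !inE => /orP[] /eqP xa; move: xI.
      by rewrite xa (negPf a1I).
    by rewrite xa (negPf a2I).
- apply: leq_num_colorings_local fresh _ _ _ _ => //.
  + move=> x xL; rewrite !inE negb_or -/D => /andP[/negPf x1 /negPf x2].
    have : x \in labels D' by rewrite labels_cat mem_cat xL.
    by rewrite lb !inE x1 x2.
  + by move=> x y xI yI; rewrite linkE.
  + move=> c /(rels_bigon _ link_a1 link_a2)/bigon_rel_ends[c1 c2].
    by exists c => // n; rewrite !inE => /orP[] /eqP->.
  + move=> c d /(rels_bigon _ link_a1 link_a2) cL.
    move=> /(rels_bigon _ link_a1 link_a2) dL ecd x xI _.
    have a1D : a1 \in labels D' by rewrite lb inE eqxx.
    have a2D : a2 \in labels D' by rewrite lb !inE eqxx !orbT.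
    move: dL; rewrite -(ecd a1) // -(ecd b1) // -(ecd a2) // -(ecd b2) // => dL.
    have [e1 e2] := bigon_rel_inj cL dL.
    by move: xI; rewrite !inE => /orP[] /eqP->.
Qed.

End Bigon.

(** * Invariance under move III *)

Section Triangle.
Variables (k12 k13 k23 : flavor) (e12 e13 e23 : bool).
Variables (a1 m1 b1 a2 m2 b2 a3 m3 b3 : nat) (K : code).
Hypothesis kinds : triangle_kinds k12 k13 k23.

Let T tau := triangle k12 k13 k23 e12 e13 e23 tau a1 m1 b1 a2 m2 b2 a3 m3 b3.
Let st := [:: (a1, m1); (m1, b1); (a2, m2); (m2, b2); (a3, m3); (m3, b3)].

(** Each strand contributes both its halves in whichever order it meets the others, so both sides of
    the move have the same strands, labels and components. *)
Lemma strands_triangle tau : perm_eq (strands (T tau ++ K)) (st ++ strands K).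
Proof.
rewrite strands_cat perm_cat2r.
rewrite -[strands _]/(node_strands _ ++ node_strands _ ++ node_strands _ ++ [::]).
rewrite cats0.
apply: perm_trans (perm_cat (strands_meet _ _ _ _)
  (perm_cat (strands_meet _ _ _ _) (strands_meet _ _ _ _))) _.
move: (tau == (e13 == e23)) (tau == (e12 == e13)) => f1 f3; apply/permP => P.
by case: f1; case: tau; case: f3; rewrite /=; lia.
Qed.

Lemma rels_triangle E c tau :
  linked E a1 m1 -> linked E a2 m2 -> linked E a3 m3 ->
  rels_at E (T tau) c <->
  meet_triangle (type_at E a1 a2) (type_at E a1 a3) (type_at E a2 a3)
    k12 k13 k23 e12 e13 e23 tau
    (c a1) (c m1) (c b1) (c a2) (c m2) (c b2) (c a3) (c m3) (c b3).
Proof.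
move=> l1 l2 l3; rewrite /T /triangle /meet_triangle; cbv zeta.
set f1 := tau == (e13 == e23); set f3 := tau == (e12 == e13).
have l a m b f : linked E a m -> linked E a (half f a m b).1.
  by case: f => // _; exact: rst_refl.
have n12 := node_rel_meet (type_at E) c k12 e12 (half f1 a1 m1 b1)
  (half tau a2 m2 b2).
have n13 := node_rel_meet (type_at E) c k13 e13 (half (~~ f1) a1 m1 b1)
  (half f3 a3 m3 b3).
have n23 := node_rel_meet (type_at E) c k23 e23 (half (~~ tau) a2 m2 b2)
  (half (~~ f3) a3 m3 b3).
rewrite !half_rel -(type_at_congr (l _ _ _ _ l1) (l _ _ _ _ l2)) in n12.
rewrite !half_rel -(type_at_congr (l _ _ _ _ l1) (l _ _ _ _ l3)) in n13.
rewrite !half_rel -(type_at_congr (l _ _ _ _ l2) (l _ _ _ _ l3)) in n23.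
split=> [ok|[r1 r2 r3] n].
  by split; [apply/n12/ok | apply/n13/ok | apply/n23/ok];
    rewrite !inE eqxx ?orbT.
by rewrite !inE => /or3P[] /eqP->; [apply/n12 | apply/n13 | apply/n23].
Qed.

(** With [tau] arbitrary, this inequality covers both directions of the move. *)
Lemma leq_num_colorings_triangle tau :
  well_formed (T tau ++ K) -> well_formed (T (~~ tau) ++ K) ->
  num_colorings (T tau ++ K) X <= num_colorings (T (~~ tau) ++ K) X.
Proof.
move=> wf wf'.
have [/= uL uE] := well_formed_strands (strands_triangle tau) wf.
have stE t s : s \in strands (T t ++ K) = (s \in st ++ strands K).
  exact: perm_mem (strands_triangle t) s.
have lb t x : x \in labels (T t ++ K) =
    (x \in [:: a1, m1, a2, m2, a3, m3 & labels K]).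
  exact: perm_mem (perm_map fst (strands_triangle t)) x.
pose I := [:: m1; m2; m3].
have [[m21 m31 m32] [a1I a2I a3I] [b1I b2I b3I] [IL IE]] : [/\
    [/\ m2 != m1, m3 != m1 & m3 != m2],
    [/\ a1 \notin I, a2 \notin I & a3 \notin I],
    [/\ b1 \notin I, b2 \notin I & b3 \notin I] &
    {in I, forall x, x \notin labels K} /\ {in I, forall x, x \notin ends K}].
  move: uL uE; rewrite /= !inE !negb_or -!andbA.
  do 21 case/andP=> ?; move=> _; do 21 case/andP=> ?; move=> _.
  split.
  - by split; rewrite eq_sym.
  - by split; apply/and3P; split; rewrite // eq_sym.
  - by split; apply/and3P; split; rewrite // eq_sym.
  - by split=> x; rewrite !inE => /or3P[] /eqP->.
have link t a b : (a, b) \in st -> linked (T t ++ K) a b.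
  by move=> ab; apply: rst_step; rewrite stE mem_cat ab.
have l1 t : linked (T t ++ K) a1 m1 by apply: link; rewrite !inE eqxx ?orbT.
have l2 t : linked (T t ++ K) a2 m2 by apply: link; rewrite !inE eqxx ?orbT.
have l3 t : linked (T t ++ K) a3 m3 by apply: link; rewrite !inE eqxx ?orbT.
have linkE x y : linked (T tau ++ K) x y <-> linked (T (~~ tau) ++ K) x y.
  by split; apply: (@linked_map _ _ id) => u v;
    rewrite !stE => uv; apply: rst_step; rewrite stE.
have bD b : b \in unzip2 st -> b \in labels (T tau ++ K).
  move=> /mapP[[a b'] ab ->].
  by have [] := strand_labels wf (_ : (a, b') \in _); rewrite // stE mem_cat ab.
apply: (@leq_num_colorings_local (T tau) (T (~~ tau)) K I) => //.
- by move=> x xI; rewrite mem_cat negb_or IL // IE.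
- by move=> x xL _; rewrite lb -(lb tau) labels_cat mem_cat xL.
- move=> c /(rels_triangle _ _ (l1 _) (l2 _) (l3 _)) ok.
  have [z1 [z2 [z3]]] :=
    meet_triangle_opp (admissible_type_at _ _ _ _) kinds ok.
  rewrite !(eq_type_at (linkE _ _)) => {}ok.
  pose c' := [eta c with m1 |-> z1, m2 |-> z2, m3 |-> z3].
  have c'E x : x \notin I -> c x = c' x.
    by rewrite !inE !negb_or /c' /= => /and3P[/negPf-> /negPf-> /negPf->].
  exists c' => //; apply/(rels_triangle _ _ (l1 _) (l2 _) (l3 _)).
  have c'm1 : c' m1 = z1 by rewrite /c' /= eqxx.
  have c'm2 : c' m2 = z2 by rewrite /c' /= (negPf m21) eqxx.
  have c'm3 : c' m3 = z3 by rewrite /c' /= (negPf m31) (negPf m32) eqxx.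
  rewrite c'm1 c'm2 c'm3 -(c'E a1) // -(c'E a2) // -(c'E a3) //.
  by rewrite -(c'E b1) // -(c'E b2) // -(c'E b3).
- move=> c d /(rels_triangle _ _ (l1 _) (l2 _) (l3 _)) cT.
  move=> /(rels_triangle _ _ (l1 _) (l2 _) (l3 _)) dT ecd x xI _.
  have [a1D a2D a3D] : [/\ a1 \in labels (T tau ++ K),
      a2 \in labels (T tau ++ K) & a3 \in labels (T tau ++ K)].
    by split; rewrite lb !inE eqxx ?orbT.
  have [b1D b2D b3D] : [/\ b1 \in labels (T tau ++ K),
      b2 \in labels (T tau ++ K) & b3 \in labels (T tau ++ K)].
    by split; apply: bD; rewrite !inE eqxx ?orbT.
  move: dT; rewrite -(ecd a1) // -(ecd a2) // -(ecd a3) //.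
  rewrite -(ecd b1) // -(ecd b2) // -(ecd b3) // => dT.
  have [e1 e2 e3] := meet_triangle_inj kinds cT dT.
  by move: xI; rewrite !inE => /or3P[] /eqP->.
Qed.

End Triangle.
End Local.

(** * Invariance and homomorphisms *)


Section Invariance.
Variables (X : finMCBiquandleType) (t : flavor).

Lemma diagram_wf (D : diagram t) : well_formed D.
Proof. by have /and3P[] := diagramP D. Qed.

Lemma num_colorings_local_move L R K : local_move L R ->
  well_formed (L ++ K) -> well_formed (R ++ K) ->
  num_colorings (L ++ K) X = num_colorings (R ++ K) X.
Proof.
case=> [k e a c b first|k e a m b c n d par|k12 k13 k23 e12 e13 e23 a1 m1 b1
  a2 m2 b2 a3 m3 b3 kinds] wf wf'.
- exact: num_colorings_loop.
- exact: num_colorings_bigon.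
- apply/eqP; rewrite eqn_leq leq_num_colorings_triangle //.
  exact: (@leq_num_colorings_triangle X _ _ _ _ _ _ _ _ _ _ _ _ _ _ _ _
    kinds false).
Qed.

Lemma step_num_colorings (D D' : diagram t) :
  step D D' -> num_colorings D X = num_colorings D' X.
Proof.
have wf := diagram_wf D; have wf' := diagram_wf D'.
case=> [DD'|f finj eD'|a b K ab eD eD'|L R K LR eD eD'].
(* The empty code is set aside because the comparison lemma takes a default color from a label. *)
- have [D0|D0] := eqVneq (D : code) [::].
    by move: DD'; rewrite D0 perm_sym => /perm_nilP->.
  apply/eqP; rewrite eqn_leq !leq_num_colorings_perm // 1?perm_sym //.
  by apply: contraNneq D0 => D'0; move: DD'; rewrite D'0 => /perm_nilP->.
- by rewrite eD' num_colorings_relabel // -eD'.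
- by rewrite eD eD' num_colorings_marker // -?eD // -eD'.
- by rewrite eD eD' (num_colorings_local_move LR) // -?eD // -eD'.
Qed.

Lemma same_link_num_colorings (D D' : diagram t) :
  same_link D D' -> num_colorings D X = num_colorings D' X.
Proof.
move/asboolP; elim=> {D D'} [D D' /step_num_colorings//|//|D D' _ ->//|].
by move=> D1 D2 D3 _ -> _ ->.
Qed.

End Invariance.

(** * Homomorphisms from the fundamental mc-biquandle and colorings *)

Section Homs.
Variables (X : finMCBiquandleType) (D : code).
Implicit Types (f : {ffun semiarc D -> X}) (w : word D).

(** [bijective] only asserts that an inverse exists; finiteness provides it as data, which [eval]
    needs. *)
Lemma finite_bij_inv (T : finType) (g : T -> T) :
  bijective g -> {h | cancel g h & cancel h g}.
Proof.
by move=> bg; exists (invF (bij_inj bg)); [exact: invF_f | exact: f_invF].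
Qed.

Definition under_inv l (y : X) := s2val (finite_bij_inv (mcb_under_bij l y)).
Definition over_inv l (y : X) := s2val (finite_bij_inv (mcb_over_bij l y)).
Definition S_inv l := s2val (finite_bij_inv (@mcb_S_bij X l)).

Fixpoint eval f w : X :=
  match w with
  | Gen s => f s
  | Under l v w => under l (eval f v) (eval f w)
  | Over l v w => over l (eval f v) (eval f w)
  | UnderInv l v w => under_inv l (eval f v) (eval f w)
  | OverInv l v w => over_inv l (eval f v) (eval f w)
  | SInv1 l v w => (S_inv l (eval f v, eval f w)).1
  | SInv2 l v w => (S_inv l (eval f v, eval f w)).2
  end.

(** Each rule of the congruence is an axiom valid in [X] or a crossing relation, which a coloring
    satisfies. *)
Lemma eval_cong f v w : is_coloring f -> cong v w -> eval f v = eval f w.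
Proof.
move=> fcol; elim=> {v w} //=; try by move=> *; congruence.
- by move=> x; exact: mcb_diag.
- by move=> l x y; exact: (s2valP (finite_bij_inv (mcb_under_bij l (eval f y)))).
- by move=> l x y; exact: (s2valP' (finite_bij_inv (mcb_under_bij l (eval f y)))).
- by move=> l x y; exact: (s2valP (finite_bij_inv (mcb_over_bij l (eval f y)))).
- by move=> l x y; exact: (s2valP' (finite_bij_inv (mcb_over_bij l (eval f y)))).
- move=> l x y; rewrite /S_inv.
  by have /= -> := s2valP (finite_bij_inv (@mcb_S_bij X l)) (eval f x, eval f y).
- move=> l x y; rewrite /S_inv.
  by have /= -> := s2valP (finite_bij_inv (@mcb_S_bij X l)) (eval f x, eval f y).
- move=> l x y; rewrite /S_inv.
  by have /= [] := s2valP' (finite_bij_inv (@mcb_S_bij X l)) (eval f x, eval f y).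
- move=> l x y; rewrite /S_inv.
  by have /= [] := s2valP' (finite_bij_inv (@mcb_S_bij X l)) (eval f x, eval f y).
- by move=> j k l x y z adm; exact: mcb_exch_oo.
- by move=> j k l x y z adm; exact: mcb_exch_uo.
- by move=> j k l x y z adm; exact: mcb_exch_uu.
- by move=> l x y x' y' /fcol[].
- by move=> l x y x' y' /fcol[].
Qed.

Definition hom_of f (a : MCB D) : X := eval f (mcb_repr a).

Lemma hom_of_class f w : is_coloring f -> hom_of f (mcb_class w) = eval f w.
Proof. by move=> fcol; apply: eval_cong fcol (cong_repr w). Qed.

Lemma hom_of_hom f : is_coloring f -> is_mc_hom (hom_of f).
Proof.
move=> fcol l; split=> a b; elim/mcb_ind: a => v; elim/mcb_ind: b => w.
  by rewrite [under l _ _]mcb_underE !hom_of_class.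
by rewrite [over l _ _]mcb_overE !hom_of_class.
Qed.

(** Induction on words. Homomorphisms are only required to preserve the four operations; for the
    inverse operations, agreement follows by undoing them and using injectivity in [X]. *)
Lemma hom_ext (g h : MCB D -> X) : is_mc_hom g -> is_mc_hom h ->
  (forall s, g (mcb_class (Gen s)) = h (mcb_class (Gen s))) -> g = h.
Proof.
have homU (k : MCB D -> X) : is_mc_hom k -> forall l v w,
    k (mcb_class (Under l v w)) = under l (k (mcb_class v)) (k (mcb_class w)).
  by move=> kM l v w; rewrite -mcb_underE; case: (kM l) => ->.
have homO (k : MCB D -> X) : is_mc_hom k -> forall l v w,
    k (mcb_class (Over l v w)) = over l (k (mcb_class v)) (k (mcb_class w)).
  by move=> kM l v w; rewrite -mcb_overE; case: (kM l) => _ ->.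
have SVK1 l v w : mcb_class (Over l (SInv2 l v w) (SInv1 l v w)) = mcb_class v.
  exact/mcb_classP/cong_SVK1.
have SVK2 l v w : mcb_class (Under l (SInv1 l v w) (SInv2 l v w)) = mcb_class w.
  exact/mcb_classP/cong_SVK2.
have homS (k : MCB D -> X) : is_mc_hom k -> forall l v w,
    over l (k (mcb_class (SInv2 l v w))) (k (mcb_class (SInv1 l v w))) =
      k (mcb_class v) /\
    under l (k (mcb_class (SInv1 l v w))) (k (mcb_class (SInv2 l v w))) =
      k (mcb_class w).
  by move=> kM l v w; rewrite -homU // -homO // SVK1 SVK2.
move=> gM hM gh; apply/funext; elim/mcb_ind; elim.
- exact: gh.
- by move=> l v ev w ew; rewrite !homU // ev ew.
- by move=> l v ev w ew; rewrite !homO // ev ew.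
- move=> l v ev w ew; apply: (@under_inj _ l (g (mcb_class v))).
  rewrite /= {2}ev -!homU //.
  by have /mcb_classP -> : cong (Under l (UnderInv l v w) v) w by exact: cong_UnderVK.
- move=> l v ev w ew; apply: (@over_inj _ l (g (mcb_class v))).
  rewrite /= {2}ev -!homO //.
  by have /mcb_classP -> : cong (Over l (OverInv l v w) v) w by exact: cong_OverVK.
- move=> l v ev w ew; have [g1 g2] := homS g gM l v w.
  have [h1 h2] := homS h hM l v w.
  rewrite ev -h1 in g1; rewrite ew -h2 in g2.
  by have [] := S_inj g1 g2.
- move=> l v ev w ew; have [g1 g2] := homS g gM l v w.
  have [h1 h2] := homS h hM l v w.
  rewrite ev -h1 in g1; rewrite ew -h2 in g2.
  by have [] := S_inj g1 g2.
Qed.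

Definition colorings : set {ffun semiarc D -> X} :=
  [set f | is_coloring f]%classic.

(** Crossing relations hold between the generators, so a homomorphism restricts to a coloring of
    them, and by [hom_ext] it is the evaluation of that coloring. *)
Lemma Hom_colorings : Hom (MCB D) X = (hom_of @` colorings)%classic.
Proof.
apply/seteqP; split=> [g gM|_ [f fcol <-]]; last exact: hom_of_hom.
pose f := [ffun s => g (mcb_class (Gen s))].
have fcol : is_coloring f.
  move=> l x y x' y' xy; rewrite !ffunE; have [gu go] := gM l.
  rewrite -gu -go [under l _ _]mcb_underE [over l _ _]mcb_overE.
  split; congr g; apply/mcb_classP; first exact: cong_crossing_under xy.
  exact: cong_crossing_over xy.
exists f => //; apply: hom_ext (hom_of_hom fcol) gM _ => s.
by rewrite hom_of_class //= ffunE.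
Qed.

Lemma finite_Hom : finite_set (Hom (MCB D) X).
Proof. by rewrite Hom_colorings; apply: finite_image; exact: finite_finset. Qed.

Lemma num_homs_colorings : num_homs (MCB D) X = num_colorings D X.
Proof.
have fin : finite_set colorings by exact: finite_finset.
rewrite /num_homs Hom_colorings fset_set_image // card_in_imfset /=.
  rewrite /num_colorings cardE; apply/perm_size/uniq_perm.
  - exact: fset_uniq.
  - exact: enum_uniq.
  - by move=> f; rewrite mem_enum inE [LHS](in_fset_set fin).
(* Distinct colorings give distinct homomorphisms, since the value at a generator is the color of
   its semiarc. *)
move=> f g /[!in_fset_set fin]/[!inE] fcol gcol efg; apply/ffunP => s.
by have := congr1 (@^~ (mcb_class (Gen s))) efg; rewrite /= !hom_of_class.
Qed.

End Homs.

Theorem theorem2 (X : finMCBiquandleType) (t : flavor) :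
  (forall (L : link t) (D : diagram t), diagram_of L D ->
     [/\ finite_set (Hom (MCB D) X),
         num_homs (MCB D) X = Phi X L &
         num_colorings D X = Phi X L]) /\
  (forall (L : link t) (D D' : diagram t),
     diagram_of L D -> diagram_of L D' ->
     num_colorings D X = num_colorings D' X).
Proof.
have reprE (L : link t) (D : diagram t) : diagram_of L D ->
    num_colorings D X = Phi X L.
  (* [Phi] is computed from the chosen representative of the class of [D], which is related to [D]
     by moves. *)
  move=> <-; rewrite /Phi num_homs_colorings.
  apply: same_link_num_colorings; apply/eqmodP; by rewrite reprK.
split=> [L D DL|L D D' /reprE-> /reprE-> //].
by rewrite num_homs_colorings (reprE _ _ DL); split=> //; exact: finite_Hom.
Qed.
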